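(* Let $a,b,c\in\mathbb{R}$, $1\le p<\infty$ and $0<q,r<\infty$. Then $W^{1,(q,p)}_{\{a,b\}}(\mathbb{R}^N_* )$ (and hence also $\widetilde W^{1,(q,p)}_{\{a,b\}}$) is not contained in $L^r(\mathbb{R}^N;|x|^c dx)$ if: (i) $c$ does not belong to the closed interval with endpoints $c^0$ and $c^1$; or (ii) ($b-p\le -N<a$ or $b-p\ge -N>a$) and $c$ does not belong to the interval with endpoints $c^0$ (included) and $-N$ (not included). Furthermore, $W^{1,(q,p)}_{\{a,b\}}(\mathbb{R}^N_* )$ (and hence also $\widetilde W^{1,(q,p)}_{\{a,b\}}$) is not continuously embedded into $L^r(\mathbb{R}^N;|x|^c dx)$ if: (iii) $\frac{a+N}{q}\ne\frac{b-p+N}{p}$, $c=c^0$ and $r\ne q$; or (iv) $\frac{a+N}{q}\ne\frac{b-p+N}{p}$, $c=c^1$ and $r<p$; or (v) $\frac{a+N}{q}=\frac{b-p+N}{p}$, $r<\min\{p,q\}$ and $c=c^0$; or (vi) $a=-N$, $b=p-N$, $r<q$ and $c=c^0$.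
   Context: $N\ge1$, $\mathbb{R}^N_*:=\mathbb{R}^N\setminus\{0\}$. For $d\in\mathbb{R}$, $0<s<\infty$, $\|u\|_{d,s}:=(\int_{\mathbb{R}^N}|x|^d|u|^s dx)^{1/s}$ and $L^s(\mathbb{R}^N;|x|^ddx)$ is the set of measurable $u$ with $\|u\|_{d,s}<\infty$ ($\{0\}$ has measure $0$). $W^{1,(q,p)}_{\{a,b\}}(\mathbb{R}^N_* )$ is the set of $u\in L^1_{loc}(\mathbb{R}^N_* )$ with $\|u\|_{a,q}<\infty$ and $\|\nabla u\|_{b,p}<\infty$ ($\nabla u$ the distributional gradient on $\mathbb{R}^N_*$), with (quasi-)norm $\|u\|_{a,q}+\|\nabla u\|_{b,p}$. For a distribution $u$ on $\mathbb{R}^N_*$, $\partial_\rho u:=\nabla u\cdot\frac{x}{|x|}$; $\widetilde W^{1,(q,p)}_{\{a,b\}}$ is the set of $u\in L^1_{loc}(\mathbb{R}^N_* )$ with $\|u\|_{a,q}<\infty$ and $\|\partial_\rho u\|_{b,p}<\infty$, with (quasi-)norm $\|u\|_{a,q}+\|\partial_\rho u\|_{b,p}$. $c^0:=\frac{r(a+N)}{q}-N$, $c^1:=\frac{r(b-p+N)}{p}-N$. *)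

(* Defs.v *)
From HB Require Import structures.
From mathcomp Require Import all_boot all_order all_algebra.
From mathcomp Require Import all_classical all_reals all_analysis.
Set Implicit Arguments. Unset Strict Implicit. Unset Printing Implicit Defensive.
Import Order.TTheory GRing.Theory Num.Theory.
Import numFieldNormedType.Exports.
Local Open Scope classical_set_scope.
Local Open Scope ring_scope.

(* N-dimensional Lebesgue measure, built as the iterated product measure      *)
(* R x R x ... x R  (n.+1 factors) of the one-dimensional Lebesgue measure.    *)
(* The product measure m1 \x m2 of two sigma-finite measures, repackaged  *)
(* under an alias so that its sigma-finite structure is canonical.          *)
Section pm.
Context d1 d2 (T1 : measurableType d1) (T2 : measurableType d2) (R : realType).
Variable m1 : {sigma_finite_measure set T1 -> \bar R}.
Variable m2 : {sigma_finite_measure set T2 -> \bar R}.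
Definition pmeas : set (T1 * T2) -> \bar R := (m1 \x m2)%E.
HB.instance Definition _ := Measure.on pmeas.
Lemma pmeas_sigma_finite : sigma_finite setT pmeas.
Proof.
have /sigma_finiteP[F [TF ndF Foo]] := sigma_finiteT m1.
have /sigma_finiteP[G [TG ndG Goo]] := sigma_finiteT m2.
exists (fun n => F n `*` G n).
 rewrite -setXTT TF TG predeqE => -[x y]; split.
    move=> [/= [n _ Fnx] [k _ Gky]]; exists (maxn n k) => //; split.
    - by move: x Fnx; exact/subsetPset/ndF/leq_maxl.
    - by move: y Gky; exact/subsetPset/ndG/leq_maxr.
  by move=> [n _ []/= ? ?]; split; exists n.
move=> k; have [? ?] := Foo k; have [? ?] := Goo k.
split; first exact: measurableX.
by rewrite /pmeas product_measure1E// lte_mul_pinfty// ge0_fin_numE.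
Qed.
HB.instance Definition _ := Measure_isSigmaFinite.Build _ _ _ pmeas
  pmeas_sigma_finite.
End pm.

Record mspace (R : realType) := MSpace {
  md : measure_display;
  mT : measurableType md;
  mmu : {sigma_finite_measure set mT -> \bar R} }.

Fixpoint lebS (R : realType) (n : nat) : mspace R :=
  match n with
  | 0 => @MSpace R _ (measurableTypeR R) (@lebesgue_measure R)
  | n'.+1 => let X := lebS R n' in
      @MSpace R _ (mT X * measurableTypeR R)%type
        (@pmeas _ _ _ _ R (mmu X) (@lebesgue_measure R))
  end.

Fixpoint lcoord (R : realType) (n : nat) : mT (lebS R n) -> 'I_n.+1 -> R :=
  match n return mT (lebS R n) -> 'I_n.+1 -> R with
  | 0 => fun y _ => y
  | n'.+1 => fun y i =>
      if (i < n'.+1)%N then @lcoord R n' y.1 (inord i) else y.2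
  end.

(* The measure space used for R^N (N >= 1) and the identification map with   *)
(* the row vectors 'rV[R]_N (the latter carry the topology / derivatives).    *)
Definition RNsp (R : realType) (N : nat) : mspace R := lebS R N.-1.
Definition lebN (R : realType) (N : nat) := mmu (RNsp R N).
Definition toRV (R : realType) (N : nat) (y : mT (RNsp R N)) : 'rV[R]_N :=
  \row_(i < N) @lcoord R N.-1 y (inord i).

Definition enorm (R : realType) (N : nat) (x : 'rV[R]_N) : R :=
  Num.sqrt (\sum_(i < N) x ord0 i ^+ 2).

Definition meas (R : realType) (N : nat) (u : 'rV[R]_N -> R) : Prop :=
  measurable_fun setT (u \o @toRV R N).

Definition intRN (R : realType) (N : nat) (f : 'rV[R]_N -> R) : \bar R :=
  (\int[lebN R N]_y (f (toRV y))%:E)%E.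

Definition wint (R : realType) (N : nat) (d s : R) (u : 'rV[R]_N -> R) : \bar R :=
  intRN (fun x => (enorm x) `^ d * `|u x| `^ s).

Definition inLw (R : realType) (N : nat) (d s : R) (u : 'rV[R]_N -> R) : Prop :=
  meas u /\ (wint d s u < +oo)%E.

(* ||u||_{d,s} (meaningful when finite) *)
Definition wnorm (R : realType) (N : nat) (d s : R) (u : 'rV[R]_N -> R) : R :=
  (fine (wint d s u)) `^ (s^-1).

Definition L1loc (R : realType) (N : nat) (u : 'rV[R]_N -> R) : Prop :=
  meas u /\
  forall K : set 'rV[R]_N, compact K -> ~ K 0 ->
    (lebN R N).-integrable (@toRV R N @^-1` K) (fun y => (u (toRV y))%:E).

Definition partial (R : realType) (N : nat) (i : 'I_N) (f : 'rV[R]_N -> R)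
  : 'rV[R]_N -> R :=
  fun x => derive f x (delta_mx 0 i : 'rV[R]_N).

Fixpoint Ck (R : realType) (N : nat) (k : nat) (f : 'rV[R]_N -> R) : Prop :=
  match k with
  | 0 => continuous f
  | k'.+1 => continuous f /\
      (forall (i : 'I_N) (x : 'rV[R]_N), derivable f x (delta_mx 0 i : 'rV[R]_N)) /\
      (forall i : 'I_N, Ck k' (partial i f))
  end.

Definition testfun (R : realType) (N : nat) (phi : 'rV[R]_N -> R) : Prop :=
  (forall k, Ck k phi) /\
  exists K : set 'rV[R]_N, [/\ compact K, ~ K 0 & forall x, ~ K x -> phi x = 0].

Definition wgrad (R : realType) (N : nat) (u : 'rV[R]_N -> R)
  (g : 'rV[R]_N -> 'rV[R]_N) : Prop :=
  forall i : 'I_N, L1loc (fun x => g x ord0 i) /\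
    forall phi, testfun phi ->
      intRN (fun x => u x * partial i phi x) = oppe (intRN (fun x => g x ord0 i * phi x)).

(* h is the distributional radial derivative d_rho u = grad u . x/|x| on      *)
(* R^N_*, i.e. <d_rho u, phi> = - sum_i \int u d_i (phi x_i/|x|), and is a    *)
(* function in L^1_loc(R^N_* )                                               *)
Definition wrad (R : realType) (N : nat) (u : 'rV[R]_N -> R)
  (h : 'rV[R]_N -> R) : Prop :=
  L1loc h /\
  forall phi, testfun phi ->
    intRN (fun x => h x * phi x) =
    oppe (\big[adde/0%E]_(i < N) intRN (fun x =>
          u x * partial i (fun y => phi y * y ord0 i / enorm y) x)).

Definition inW (R : realType) (N : nat) (a b q p : R) (u : 'rV[R]_N -> R)
  (g : 'rV[R]_N -> 'rV[R]_N) : Prop :=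
  [/\ L1loc u, wgrad u g, inLw a q u & inLw b p (fun x => enorm (g x))].

Definition inWt (R : realType) (N : nat) (a b q p : R) (u : 'rV[R]_N -> R)
  (h : 'rV[R]_N -> R) : Prop :=
  [/\ L1loc u, wrad u h, inLw a q u & inLw b p h].

Definition W_sub_L (R : realType) (N : nat) (a b q p c r : R) : Prop :=
  forall u g, @inW R N a b q p u g -> inLw c r u.
Definition Wt_sub_L (R : realType) (N : nat) (a b q p c r : R) : Prop :=
  forall u h, @inWt R N a b q p u h -> inLw c r u.

Definition W_emb_L (R : realType) (N : nat) (a b q p c r : R) : Prop :=
  @W_sub_L R N a b q p c r /\
  exists C : R, forall u g, @inW R N a b q p u g ->
    wnorm c r u <= C * (wnorm a q u + wnorm b p (fun x => enorm (g x))).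
Definition Wt_emb_L (R : realType) (N : nat) (a b q p c r : R) : Prop :=
  @Wt_sub_L R N a b q p c r /\
  exists C : R, forall u h, @inWt R N a b q p u h ->
    wnorm c r u <= C * (wnorm a q u + wnorm b p h).

Definition c0 (R : realType) (N : nat) (a q r : R) : R := r * (a + N%:R) / q - N%:R.
Definition c1 (R : realType) (N : nat) (b p r : R) : R := r * (b - p + N%:R) / p - N%:R.

(* Main.v *)
Require Import Defs.
From HB Require Import structures.
From mathcomp Require Import all_boot all_order all_algebra.
From mathcomp Require Import all_classical all_reals all_analysis.
From mathcomp Require Import measurable_realfun ring lra.
Set Implicit Arguments. Unset Strict Implicit. Unset Printing Implicit Defensive.
Import Order.TTheory GRing.Theory Num.Theory.
Import numFieldNormedType.Exports.
Local Open Scope classical_set_scope.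
Local Open Scope ring_scope.

(* All counterexamples are C^1 functions u on R^N minus the origin, for which
   the distributional gradient is the classical one: integrate d_i (u phi) over
   R^N by Fubini and the fundamental theorem of calculus.  With
   al0 = (a+N)/q, al1 = (b-p+N)/p, gam = (c+N)/r and t = sgm * ln |x|
   (sgm = 1 looks at infinity, sgm = -1 at the origin), a radial function
   u(x) = F(t) has ||u||_{a,q} finite iff exp(sgm al0 t) F is in L^q(dt), and
   similarly al1, F', p for the gradient and gam, F, r for the target norm; only
   the order of magnitude e^{sgm k N} of the measure of the shells
   k <= t < k+1 is needed.  The profiles F = exp(-al t) (1+t)^(-be), cut off
   for t <= 0, with be = 0 or 1/r, show that W is not contained in L^r in all
   cases but (iii) with q < r.  There a bump of width eps * rho at distance rho
   from the origin is used: letting rho tend to 0 or infinity makes the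
   gradient term negligible, and then eps -> 0 contradicts the embedding. *)

(** * Measurability and Lebesgue measure of cubes *)

(** At a critical exponent, exp(sgm al t) F behaves like (1+t)^(-be), which lies in L^q(dt) iff be q
    > 1 and outside L^r(dt) iff be r <= 1. Both can hold only if r < q, and be = 1/r is the extreme
    choice; away from critical exponents the exponential gap leaves room for be = 0. This is why
    (iii) with q < r needs concentration instead: for c = c^0 the L^q and L^r norms of the bump
    carry the same power of rho and their ratio is governed by eps^(N/q - N/r), while the gradient
    term carries another power of rho because al0 and al1 differ. The shift from b to b-p in al1
    comes from |grad u| = |F'(t)| / |x|. C^1 regularity off the origin suffices, however singular u
    is there: a test function vanishes near the origin, so u phi extends by zero across it. The
    spaces with the radial derivative need no separate examples, since the radial derivative of the
    same u is at most N |grad u|. *)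

Lemma toRVE (R : realType) n (y : mT (lebS R n)) (i : 'I_n.+1) :
  @toRV R n.+1 y ord0 i = lcoord y i.
Proof. by rewrite mxE inord_val. Qed.

Lemma measurable_lcoord (R : realType) n (i : 'I_n.+1) :
  measurable_fun setT (fun y : mT (lebS R n) => lcoord y i).
Proof.
elim: n i => [|n IHn] i /=; first exact: measurable_id.
have [_|_] := boolP (i < n.+1)%N; last exact: measurable_snd.
exact: measurableT_comp (IHn _) measurable_fst.
Qed.

(** Measurability lives on the iterated product and topology on row vectors. Second countability
    links them: an open set is a countable union of cubes with rational centre and radius
    1/(k+1). *)
Lemma measurable_toRV_open (R : realType) n (U : set 'rV[R]_n.+1) :
  open U -> measurable (@toRV R n.+1 @^-1` U).
Proof.
move=> oU.
pose B (ck : 'rV[rat]_n.+1 * nat) : set (mT (lebS R n)) :=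
  [set y | forall i, `|lcoord y i - ratr (ck.1 ord0 i)| < (ck.2.+1%:R)^-1].
pose ctr (ck : 'rV[rat]_n.+1 * nat) : 'rV[R]_n.+1 := map_mx ratr ck.1.
pose P : set ('rV[rat]_n.+1 * nat) :=
  [set ck | ball (ctr ck) (ck.2.+1%:R)^-1 `<=` U].
have -> : @toRV R n.+1 @^-1` U = \bigcup_(ck in P) B ck.
  apply/seteqP; split => [y /= Uy|y [[c k] /= Pck Bck]]; last first.
    apply: Pck; split; first by rewrite invr_gt0.
    by move=> i j; rewrite (ord1 i) toRVE mxE /ball/= distrC; exact: Bck.
  have /nbhs_ballP[e /= e0 eU] := open_nbhs_nbhs (conj oU Uy).
  have [k ke] : exists k : nat, (k.+1%:R : R)^-1 < e / 2.
    have e20 : 0 < e / 2 by rewrite divr_gt0.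
    have [k _ /(_ k (leqnn k))] := near_infty_natSinv_lt (PosNum e20).
    by exists k.
  have k0 : 0 < (k.+1%:R : R)^-1 by rewrite invr_gt0.
  have /choice[c cP] : forall i : 'I_n.+1, exists c : rat,
      `|lcoord y i - ratr c| < (k.+1%:R)^-1.
    move=> i; have /rat_in_itvoo[c] : lcoord y i - (k.+1%:R)^-1 < lcoord y i + (k.+1%:R)^-1.
      by rewrite ltrD2l gtrN.
    by rewrite in_itv/= => cc; exists c; rewrite distrC ltr_distl.
  exists (\row_i c i, k) => [z [_ cz]|i]; last by rewrite mxE; exact: cP.
  apply: eU; split => // i j; rewrite (ord1 i) toRVE /ball/=.
  have := cz ord0 j; rewrite /ctr !mxE /ball/= => H.
  rewrite (splitr e) (le_lt_trans (ler_distD (ratr (c j)) _ _))// ltrD//.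
    exact: lt_trans (cP j) ke.
  exact: lt_trans H ke.
rewrite bigcup_mkcond.
apply: countable_bigcupT_measurable => [|[c k]]; first exact: countableP.
case: ifP => // _.
have -> : B (c, k) = \bigcap_(i in [set: 'I_n.+1])
    [set y | `|lcoord y i - ratr (c ord0 i)| < (k.+1%:R)^-1].
  by apply/seteqP; split => [y /= h i _|y /= h i]; [exact: h|exact: h].
apply: fin_bigcap_measurable => // i _.
rewrite -[X in measurable X]setTI.
have mf : measurable_fun setT (fun y : mT (lebS R n) => `|lcoord y i - ratr (c ord0 i)|).
  apply: measurableT_comp => //; apply: measurable_funB => //.
  exact: measurable_lcoord.
have := mf measurableT `]-oo, (k.+1%:R)^-1[%classic (measurable_itv _).
congr measurable; apply/seteqP; split => y /=; rewrite in_itv/=; by [].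
Qed.

(** The value at the origin may be an artefact of conventions such as [ln 0 = 0], so the preimage of
    an interval is an open set to which the single point 0 may have to be added. *)
Lemma meas_continuous_off0 (R : realType) n (u : 'rV[R]_n.+1 -> R) :
  (forall x, x != 0 -> {for x, continuous u}) -> meas u.
Proof.
move=> cu; apply: (measurability _ (RGenOpens.measurableE R)).
move=> _ [_ [a [b ->] <-]]; rewrite setTI.
pose I : set R := `]a, b[%classic.
have oI : open I by exact: interval_open.
rewrite -/I.
have mZ : measurable (@toRV R n.+1 @^-1` [set 0]).
  rewrite -[X in measurable X]setCK; apply: measurableC.
  apply: (@measurable_toRV_open _ _ (~` [set 0])); rewrite openC.
  exact: (@accessible_closed_set1 _ (hausdorff_accessible (@norm_hausdorff _ _))).
have oV : open (u @^-1` I `&` [set x | x != 0]).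
  rewrite openE => x [/= Ix x0]; rewrite /interior; apply: filterI.
    exact: (cu x x0 _ (open_nbhs_nbhs (conj oI Ix))).
  apply: open_nbhs_nbhs; split => //.
  have -> : [set x : 'rV[R]_n.+1 | x != 0] = ~` [set 0].
    by apply/seteqP; split => y /= /eqP.
  rewrite openC.
  exact: (@accessible_closed_set1 _ (hausdorff_accessible (@norm_hausdorff _ _))).
have -> : (u \o @toRV R n.+1) @^-1` I = (@toRV R n.+1 @^-1` (u @^-1` I `&` [set x | x != 0]))
    `|` (if u 0 \in I then @toRV R n.+1 @^-1` [set 0] else set0).
  apply/seteqP; split => [y /= Iy|y /=].
    have [y0|y0] := eqVneq (@toRV R n.+1 y) 0; last by left.
    by right; rewrite y0 in Iy; rewrite mem_set.
  move=> [[]//|]; case: ifPn => // /set_mem Iu /= y0.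
  by rewrite /preimage/= y0.
apply: measurableU; first exact: measurable_toRV_open.
by case: ifP.
Qed.

Definition cube (R : realType) n (l h : R) : set (mT (lebS R n)) :=
  [set y | forall i, l < lcoord y i < h].

Lemma cubeS (R : realType) n (l h : R) :
  @cube R n.+1 l h = @cube R n l h `*` `]l, h[%classic.
Proof.
apply/seteqP; split => [y /= cy|[y z] [/= cy cz] i /=].
  split.
    move=> i; have := cy (widen_ord (leqnSn _) i).
    by rewrite /= ltn_ord (_ : inord _ = i)//; apply/val_inj; rewrite /= inordK.
  by have := cy ord_max; rewrite /= ltnn in_itv.
case: ifP => _; first exact: cy.
by move: cz; rewrite in_itv.
Qed.

Lemma measurable_cube (R : realType) n (l h : R) : measurable (@cube R n l h).
Proof.
elim: n => [|n IHn]; last by rewrite cubeS; exact: measurableX.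
rewrite (_ : @cube R 0 l h = `]l, h[%classic); first exact: measurable_itv.
by apply/seteqP; split => [y /= /(_ ord0)|y /=]; rewrite in_itv/= => // yl i.
Qed.

Lemma measure_cube (R : realType) n (l h : R) : l < h ->
  mmu (lebS R n) (cube l h) = ((h - l) ^+ n.+1)%:E.
Proof.
move=> lh; have lebI : lebesgue_measure `]l, h[%classic = (h - l)%:E.
  by rewrite lebesgue_measure_itv/= lte_fin lh EFinB.
elim: n => [|n IHn].
  rewrite (_ : @cube R 0 l h = `]l, h[%classic) ?expr1//.
  by apply/seteqP; split => [y /= /(_ ord0)|y /=]; rewrite in_itv/= => // yl i.
rewrite cubeS [LHS]product_measure1E//; last exact: measurable_cube.
by rewrite [X in (X * _)%E]IHn [X in (_ * X)%E]lebI -EFinM -exprSr.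
Qed.

Lemma integrable_bounded_cube (R : realType) n (D : 'rV[R]_n.+1 -> R) (M B : R) :
  meas D -> (forall x, `|D x| <= B) ->
  (forall x : 'rV[R]_n.+1, (exists i, M <= `|x ord0 i|) -> D x = 0) ->
  (mmu (lebS R n)).-integrable setT (fun y => (D (@toRV R n.+1 y))%:E).
Proof.
move=> mD DB D0.
have B0 : 0 <= B by apply: le_trans (DB 0).
(* [M] may be nonpositive, whereas [measure_cube] requires a nondegenerate cube. *)
pose M1 := Num.max M 1.
have M10 : 0 < M1 by rewrite lt_max ltr01 orbT.
have mC := @measurable_cube R n (- M1) M1.
apply: (@le_integrable _ _ _ _ _ measurableT _ (fun y => B%:E * (\1_(cube (- M1) M1) y)%:E)%E).
- exact/measurable_EFinP.
- move=> y _; rewrite -EFinM lee_fin/= indicE.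
  have [yC|yC] := boolP (y \in cube (- M1) M1).
    by rewrite mulr1 (le_trans (DB _))// ler_norm.
  rewrite D0 ?normr0//; apply: contrapT => H; move/negP: yC; apply; rewrite inE => i.
  have : ~~ (M <= `|lcoord y i|) by apply/negP => h; apply: H; exists i; rewrite toRVE.
  rewrite -ltNge ltr_norml => /andP[h1 h2].
  rewrite (lt_le_trans h2) ?le_max ?lexx// andbT (le_lt_trans _ h1)//.
  by rewrite lerN2 le_max lexx.
- apply: integrableZl => //; apply/integrableP; split.
    exact/measurable_EFinP.
  rewrite (eq_integral (fun y => (\1_(cube (- M1) M1) y)%:E)) => [|y _]; last first.
    by rewrite gee0_abs// lee_fin.
  by rewrite integral_indic// setIT [ltLHS]measure_cube ?ltry// gtrN.
Qed.

(** * Integration by parts *)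

(** The two difference quotients are the same function of the increment, so one-variable calculus
    applies to every directional derivative. *)
Lemma is_derive_line (R : realType) (V : normedModType R) (f : V -> R) (x v : V) (t d : R) :
  is_derive (t *: v + x) v f d <-> is_derive t 1 (fun s => f (s *: v + x)) d.
Proof.
have E : (fun h : R => h^-1 *: ((f \o shift (t *: v + x)) (h *: v) - f (t *: v + x))) =
    (fun h : R => h^-1 *: (((fun s => f (s *: v + x)) \o shift t) (h *: (1 : R))
       - f (t *: v + x))).
  apply/funext => h /=; congr (_ *: (f _ - _)).
  by rewrite /shift/= scalerDl addrA -scalerA scale1r.
by split=> -[h1 h2]; split; move: h1 h2; rewrite /derivable /derive E.
Qed.

Lemma integral_derive1_eq0 (R : realType) (phi d : R -> R) (M : R) :
  (forall t, is_derive t (1 : R) phi (d t)) -> continuous d ->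
  (forall t, M <= `|t| -> phi t = 0 /\ d t = 0) ->
  (\int[lebesgue_measure]_t (d t)%:E = 0)%E.
Proof.
move=> dphi cd supp; pose M1 := Num.max M 1.
have MM1 : M <= M1 by rewrite le_max lexx.
have M10 : 0 < M1 by rewrite lt_max ltr01 orbT.
have cphi : continuous phi.
  by move=> t; apply/differentiable_continuous/derivable1_diffP; case: (dphi t).
have -> : (\int[lebesgue_measure]_t (d t)%:E =
    \int[lebesgue_measure]_(t in `[(- M1)%R, M1]) (d t)%:E)%E.
  rewrite [RHS]integral_mkcond; apply: eq_integral => t _; rewrite patchE.
  case: ifPn => // /negP tM; rewrite (supp t _).2//.
  rewrite leNgt; apply/negP => /(fun h => lt_le_trans h MM1); rewrite ltr_norml => /andP[h1 h2].
  by apply: tM; rewrite inE/= in_itv/= !ltW.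
rewrite (@continuous_FTC2 _ d phi).
- by rewrite !(supp _ _).1 ?sube0// ?normrN ger0_norm ?(ltW M10).
- by rewrite gtrN.
- exact: continuous_subspaceT.
- split => [t _||].
  + by case: (dphi t).
  + exact: cvg_at_right_filter (cphi _).
  + exact: cvg_at_left_filter (cphi _).
- by move=> t _; rewrite derive1E; apply: derive_val.
Qed.

(** Follows the nesting of [lebS], whose outermost factor is the last coordinate. *)
Definition row_rcons (R : realType) n (x : 'rV[R]_n) (z : R) : 'rV[R]_n.+1 :=
  \row_j (if unlift ord_max j is Some k then x ord0 k else z).

Lemma toRV_pair (R : realType) n (y : mT (lebS R n)) (z : R) :
  @toRV R n.+2 ((y, z) : mT (lebS R n.+1)) = row_rcons (@toRV R n.+1 y) z.
Proof.
apply/rowP => j; rewrite toRVE mxE.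
have -> : lcoord ((y, z) : mT (lebS R n.+1)) j =
  if (j < n.+1)%N then lcoord y (inord j) else z by [].
case: unliftP => [k ->|->]; last by rewrite ltnn.
by rewrite lift_max ltn_ord toRVE inord_val.
Qed.

Lemma row_rcons_lift (R : realType) n (x : 'rV[R]_n) (z s : R) (i : 'I_n) :
  row_rcons (s *: delta_mx 0 i + x) z =
  s *: delta_mx 0 (lift ord_max i) + row_rcons x z.
Proof.
apply/rowP => j; rewrite !mxE; case: unliftP => [k ->|->].
  by rewrite !mxE (inj_eq lift_inj).
by rewrite eqxx/= (negbTE (neq_lift _ _)) mulr0 add0r.
Qed.

Lemma row_rcons_max (R : realType) n (x : 'rV[R]_n) (z s : R) :
  row_rcons x (s + z) = s *: delta_mx 0 ord_max + row_rcons x z.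
Proof.
apply/rowP => j; rewrite !mxE; case: unliftP => [k ->|->].
  by rewrite eqxx/= eq_sym (negbTE (neq_lift _ _)) mulr0 add0r.
by rewrite !eqxx mulr1.
Qed.

Lemma continuous_mx (R : realType) (T : topologicalType) n (f : T -> 'rV[R]_n) x :
  (forall i, {for x, continuous (fun y => f y ord0 i)}) -> {for x, continuous f}.
Proof.
move=> cf.
have allnear (P : 'I_n -> T -> Prop) : (forall i, \forall y \near x, P i y) ->
    \forall y \near x, forall i, P i y.
  move=> nP; have : \forall y \near x, forall i, i \in enum 'I_n -> P i y.
    elim: (enum 'I_n) => [|j s IHs]; first by apply: filterE.
    apply: filterS2 IHs (nP j) => y h Pj i; rewrite inE => /predU1P[->//|].
    exact: h.
  by apply: filterS => y h i; apply: h; rewrite mem_enum.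
apply/(@cvgrPdist_lt _ 'rV[R]_n) => e e0; near=> y.
rewrite [ltLHS]/Num.norm/= mx_normrE; apply: bigmax_lt => // -[i j] _ /=.
rewrite (ord1 i) !mxE; move: j; near: y.
apply: allnear => j.
by have /cvgrPdist_lt := cf j; apply.
Unshelve. all: by end_near. Qed.

Lemma continuous_coord (R : realType) n (i : 'I_n) :
  continuous (fun x : 'rV[R]_n => x ord0 i).
Proof. by move=> x; exact: coord_continuous. Qed.

Lemma row_rcons_continuousl (R : realType) n (z : R) :
  continuous (fun x : 'rV[R]_n => row_rcons x z).
Proof.
move=> x; apply: continuous_mx => j.
case: (unliftP ord_max j) => [k ->|->].
  rewrite (_ : (fun _ => _) = (fun y : 'rV[R]_n => y ord0 k)).
    exact: continuous_coord.
  by apply/funext => y; rewrite mxE liftK.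
rewrite (_ : (fun _ => _) = cst z); first exact: cst_continuous.
by apply/funext => y; rewrite mxE unlift_none.
Qed.

Lemma row_rcons_continuousr (R : realType) n (x : 'rV[R]_n) :
  continuous (row_rcons x).
Proof.
move=> z; apply: continuous_mx => j.
case: (unliftP ord_max j) => [k ->|->].
  rewrite (_ : (fun _ => _) = cst (x ord0 k)); first exact: cst_continuous.
  by apply/funext => y; rewrite mxE liftK.
rewrite (_ : (fun _ => _) = id) => //.
by apply/funext => y; rewrite mxE unlift_none.
Qed.

(** Induction on the dimension through Fubini. If [i] is the last coordinate, it is integrated first
    and the fundamental theorem gives 0; otherwise the last coordinate is frozen and the induction
    hypothesis applies to each slice. Boundedness and the support condition give the integrability
    that Fubini requires. *)
Lemma integral_partial_eq0 (R : realType) n (i : 'I_n.+1)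
    (Phi D : 'rV[R]_n.+1 -> R) (M B : R) :
  continuous D -> (forall x, `|D x| <= B) ->
  (forall x : 'rV[R]_n.+1, (exists j, M <= `|x ord0 j|) -> Phi x = 0 /\ D x = 0) ->
  (forall x, is_derive x (delta_mx 0 i : 'rV[R]_n.+1) Phi (D x)) ->
  (\int[mmu (lebS R n)]_y (D (@toRV R n.+1 y))%:E = 0)%E.
Proof.
elim: n i Phi D => [|n IHn] i Phi D cD DB supp dPhi.
  set v : 'rV[R]_1 := delta_mx 0 i in dPhi.
  have toRV1 (t : R) : @toRV R 1 t = t *: v + 0.
    by apply/rowP => j; rewrite toRVE addr0 !mxE (ord1 i) (ord1 j) !eqxx/= mulr1.
  transitivity (\int[@lebesgue_measure R]_t (D (t *: v + 0))%:E)%E.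
    by apply: eq_integral => t _; rewrite toRV1.
  have v0 : v ord0 ord0 = 1 by rewrite mxE (ord1 i) eqxx.
  apply: (@integral_derive1_eq0 _ (fun t => Phi (t *: v + 0)) _ M).
  - by move=> t; exact: (is_derive_line _ _ _ _ _).1 (dPhi _).
  - move=> t; apply: (@continuous_comp _ _ _ (fun t : R => t *: v + 0) D); last exact: cD.
    apply: continuous_mx => j; rewrite (ord1 j).
    rewrite (_ : (fun y : R => _) = id)//; apply/funext => s.
    by rewrite addr0 mxE v0 mulr1.
  - by move=> t Mt; apply: supp; exists ord0; rewrite addr0 mxE v0 mulr1.
have mD : meas D by apply: meas_continuous_off0 => x _; exact: cD.
have iD : ((mmu (lebS R n)) \x lebesgue_measure)%E.-integrable setT
    (fun y : mT (lebS R n) * measurableTypeR R => (D (@toRV R n.+2 y))%:E).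
  apply: (@integrable_bounded_cube R n.+1 D M B mD DB).
  by move=> x /supp[].
case: (unliftP ord_max i) => [k ik|ik].
  transitivity (\int[lebesgue_measure]_z \int[mmu (lebS R n)]_y
      (D (@toRV R n.+2 ((y, z) : mT (lebS R n.+1))))%:E)%E.
    by rewrite [RHS](integral21_prod_meas1 iD).
  apply: integral0_eq => z _.
  under eq_integral do rewrite toRV_pair.
  apply: (IHn k (fun x => Phi (row_rcons x z)) (fun x => D (row_rcons x z))) => //.
  - by move=> x; apply: continuous_comp; [exact: row_rcons_continuousl|exact: cD].
  - by move=> x [j xj]; apply: supp; exists (lift ord_max j); rewrite mxE liftK.
  - move=> x; have := dPhi (row_rcons x z).
    rewrite -[in X in X -> _](add0r (row_rcons x z)) -(scale0r (delta_mx 0 i)).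
    move/is_derive_line; rewrite scale0r add0r => H.
    rewrite -[x in is_derive x](add0r x) -(scale0r (delta_mx 0 k)).
    apply: (is_derive_line _ _ _ _ _).2.
    rewrite (_ : (fun s : R => _) =
      (fun s : R => Phi (s *: delta_mx 0 i + row_rcons x z)))//.
    by apply/funext => s; rewrite row_rcons_lift ik.
transitivity (\int[mmu (lebS R n)]_y \int[lebesgue_measure]_z
    (D (@toRV R n.+2 ((y, z) : mT (lebS R n.+1))))%:E)%E.
  by rewrite [RHS](integral12_prod_meas1 iD).
apply: integral0_eq => y _.
under eq_integral do rewrite toRV_pair.
apply: (@integral_derive1_eq0 _ (fun z => Phi (row_rcons (@toRV R n.+1 y) z)) _ M).
- move=> z; have rE (s : R) : row_rcons (@toRV R n.+1 y) s =
      s *: delta_mx 0 i + row_rcons (@toRV R n.+1 y) 0.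
    by rewrite ik -row_rcons_max addr0.
  have := (is_derive_line _ _ _ _ _).1 (dPhi (z *: delta_mx 0 i + row_rcons (@toRV R n.+1 y) 0)).
  rewrite -rE; set f1 := fun s => _; set f2 := fun s => _.
  by rewrite (_ : f1 = f2)//; apply/funext => s; rewrite /f1 -rE.
- by move=> z; apply: continuous_comp; [exact: row_rcons_continuousr|exact: cD].
- by move=> z Mz; apply: supp; exists ord_max; rewrite mxE unlift_none.
Qed.

Definition c1_off0 (R : realType) n (u : 'rV[R]_n.+1 -> R)
    (g : 'rV[R]_n.+1 -> 'rV[R]_n.+1) : Prop :=
  forall x, x != 0 -> [/\ {for x, continuous u},
    forall i, {for x, continuous (fun y => g y ord0 i)} &
    forall i, is_derive x (delta_mx 0 i : 'rV[R]_n.+1) u (g x ord0 i)].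

Section off0.
Variables (R : realType) (n : nat) (K : set 'rV[R]_n.+1).
Hypotheses (cK : compact K) (K0 : ~ K 0).

Lemma compact_rV_closed : closed K.
Proof. exact: compact_closed (@norm_hausdorff _ _) cK. Qed.

Lemma compact_rV_bounded : exists M, forall x, K x -> forall i, `|x ord0 i| < M.
Proof.
have [M [_ HM]] := compact_bounded cK.
exists (M + 2) => x Kx i; apply: (@le_lt_trans _ _ `|x|).
  by rewrite [leRHS]/Num.norm/= mx_normrE; apply/bigmax_geP; right; exists (ord0, i).
by apply: (@le_lt_trans _ _ (M + 1)); [apply: HM => //; rewrite ltrDl|rewrite ltrD2l ltr1n].
Qed.

Lemma continuous_off0_bounded (D : 'rV[R]_n.+1 -> R) :
  (forall x, x != 0 -> {for x, continuous D}) -> exists B, forall x, K x -> `|D x| <= B.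
Proof.
move=> cD; have cDK : compact (D @` K).
  apply: continuous_compact => //; apply: continuous_in_subspaceT => x /set_mem Kx.
  by apply: cD; apply/eqP => x0; apply: K0; rewrite -x0.
have [M [_ HM]] := compact_bounded cDK.
by exists (M + 1) => x Kx; apply: (HM (M + 1)); [rewrite ltrDl|exists x].
Qed.

Lemma integrable_off0 (D : 'rV[R]_n.+1 -> R) : meas D ->
  (exists B, forall x, K x -> `|D x| <= B) -> (forall x, ~ K x -> D x = 0) ->
  (mmu (lebS R n)).-integrable setT (fun y => (D (@toRV R n.+1 y))%:E).
Proof.
move=> mD [B DB] D0; have [M KM] := compact_rV_bounded.
apply: (@integrable_bounded_cube _ _ D M (Num.max B 0)) => // x.
  have [/DB DxB|/D0->] := pselect (K x); first by rewrite le_max DxB.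
  by rewrite normr0 le_max lexx orbT.
by move=> [i Mi]; apply: D0 => /KM/(_ i); rewrite ltNge Mi.
Qed.

Lemma integrable_continuous_off0 (D : 'rV[R]_n.+1 -> R) :
  (forall x, x != 0 -> {for x, continuous D}) -> (forall x, ~ K x -> D x = 0) ->
  (mmu (lebS R n)).-integrable setT (fun y => (D (@toRV R n.+1 y))%:E).
Proof.
move=> cD D0; apply: integrable_off0 => //; first exact: meas_continuous_off0.
exact: continuous_off0_bounded.
Qed.

Lemma near_notin_compact x : ~ K x -> \forall y \near x, ~ K y.
Proof.
move=> nKx; have := compact_rV_closed; rewrite -openC => oK.
exact: (open_nbhs_nbhs (conj oK nKx)).
Qed.

Lemma is_derive_notin (phi : 'rV[R]_n.+1 -> R) x v :
  (forall y, ~ K y -> phi y = 0) -> ~ K x -> is_derive x v phi 0.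
Proof.
move=> phi0 nKx; apply: (@near_eq_is_derive _ _ _ (cst 0) phi).
by apply: filterS (near_notin_compact nKx) => y /phi0 ->.
Qed.

(** As [K] is closed and misses the origin, the product [u * phi] vanishes near 0 and its partial
    derivative is continuous on the whole space. The function [phi] is asked to be C^1 only off the
    origin so that phi x_i / |x| is admissible for the radial derivative. *)
Lemma integration_by_parts_off0 (i : 'I_n.+1) (u ui phi phii : 'rV[R]_n.+1 -> R) :
  (forall x, ~ K x -> phi x = 0) -> (forall x, ~ K x -> phii x = 0) ->
  (forall x, x != 0 -> [/\ {for x, continuous u}, {for x, continuous ui} &
     is_derive x (delta_mx 0 i : 'rV[R]_n.+1) u (ui x)]) ->
  (forall x, x != 0 -> [/\ {for x, continuous phi}, {for x, continuous phii} &
     is_derive x (delta_mx 0 i : 'rV[R]_n.+1) phi (phii x)]) ->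
  intRN (fun x => u x * phii x) = (- intRN (fun x => (ui x * phi x)%R))%E.
Proof.
move=> phi0 phii0 hu hphi.
pose D x := u x * phii x + phi x * ui x.
have cDo x : x != 0 -> {for x, continuous D}.
  move=> x0; have [? ? _] := hu x x0; have [? ? _] := hphi x x0.
  by apply: continuousD; apply: continuousM.
have D0 x : ~ K x -> D x = 0.
  by move=> nKx; rewrite /D phi0// phii0// mulr0 mul0r addr0.
have [B DB] := continuous_off0_bounded cDo.
have [M KM] := compact_rV_bounded.
have intD : (\int[mmu (lebS R n)]_y (D (@toRV R n.+1 y))%:E = 0)%E.
  apply: (@integral_partial_eq0 _ _ i (fun x => u x * phi x) D M (Num.max B 0)).
  - move=> x; have [->|x0] := eqVneq x 0; last exact: cDo.
    have e : {near (0 : 'rV[R]_n.+1), cst 0 =1 D}.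
      by apply: filterS (near_notin_compact K0) => y /D0 ->.
    rewrite /continuous_at D0//.
    exact: cvg_trans (near_eq_cvg e) (cvg_cst (0 : R)).
  - move=> x; have [/DB DxB|/D0->] := pselect (K x); first by rewrite le_max DxB.
    by rewrite normr0 le_max lexx orbT.
  - move=> x [j Mj]; have nKx : ~ K x by move=> /KM/(_ j); rewrite ltNge Mj.
    by rewrite D0// phi0// mulr0.
  - move=> x; have [->|x0] := eqVneq x 0.
      rewrite D0//; apply: is_derive_notin K0 => y nKy; by rewrite phi0// mulr0.
    have [_ _ du] := hu x x0; have [_ _ dphi] := hphi x x0.
    exact: (is_deriveM du dphi).
have i1 : (mmu (lebS R n)).-integrable setT
    (fun y => (u (@toRV R n.+1 y) * phii (@toRV R n.+1 y))%:E).
  apply: (@integrable_continuous_off0 (fun x => u x * phii x)) => x x0.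
    have [? ? _] := hu x x0; have [? ? _] := hphi x x0; exact: continuousM.
  by rewrite phii0// mulr0.
have i2 : (mmu (lebS R n)).-integrable setT
    (fun y => (ui (@toRV R n.+1 y) * phi (@toRV R n.+1 y))%:E).
  apply: (@integrable_continuous_off0 (fun x => ui x * phi x)) => x x0.
    have [? ? _] := hu x x0; have [? ? _] := hphi x x0; exact: continuousM.
  by rewrite phi0// mulr0.
move: intD; under eq_integral do rewrite EFinD [X in (_ + X%:E)%E]mulrC.
rewrite integralD// /intRN /lebN /RNsp/= -(fineK (integrable_fin_num _ i1))//.
rewrite -(fineK (integrable_fin_num _ i2))// -EFinD -EFinN => -[/eqP].
by rewrite addr_eq0 => /eqP ->.
Qed.

End off0.

(** * The Euclidean norm and weak derivatives of C^1 functions *)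

(** Only a directional derivative of [S] is assumed, so the chain rule is applied on the line
    through [x] along [v]. *)
Lemma is_derive_chain (R : realType) (V : normedModType R) (S : V -> R) (F : R -> R)
    (x v : V) (d d' : R) :
  is_derive x v S d -> is_derive (S x) 1 F d' -> is_derive x v (F \o S) (d' * d).
Proof.
move=> dS dF; rewrite -[x in is_derive x](add0r x) -(scale0r v).
apply: (is_derive_line _ _ _ _ _).2.
apply: (@is_derive1_comp _ F (fun s => S (s *: v + x))).
  by rewrite scale0r add0r.
by apply: (is_derive_line _ _ _ _ _).1; rewrite scale0r add0r.
Qed.

Lemma is_derive_coord (R : realType) n (x : 'rV[R]_n) (i j : 'I_n) :
  is_derive x (delta_mx 0 i : 'rV[R]_n) (fun y : 'rV[R]_n => y ord0 j) (j == i)%:R.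
Proof.
rewrite -[x in is_derive x](add0r x) -(scale0r (delta_mx 0 i)).
apply: (is_derive_line _ _ _ _ _).2.
rewrite (_ : (fun s : R => _) = (fun s : R => s * (j == i)%:R + x ord0 j)); last first.
  by apply/funext => s; rewrite !mxE eqxx.
have H := is_deriveD (is_deriveM (is_derive_id (0 : R) 1)
  (is_derive_cst ((j == i)%:R : R) (0 : R) 1)) (is_derive_cst (x ord0 j) (0 : R) 1).
by apply: (is_derive_eq H); rewrite addr0 scaler0 add0r /GRing.scale/= mulr1.
Qed.

Definition sqnorm (R : realType) n (x : 'rV[R]_n) : R := \sum_(i < n) x ord0 i ^+ 2.

Lemma sqnorm_ge0 (R : realType) n (x : 'rV[R]_n) : 0 <= sqnorm x.
Proof. by apply: sumr_ge0 => i _; exact: sqr_ge0. Qed.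

Lemma enorm_sq (R : realType) n (x : 'rV[R]_n) : enorm x ^+ 2 = sqnorm x.
Proof. by rewrite sqr_sqrtr// sqnorm_ge0. Qed.

Lemma enorm_ge0 (R : realType) n (x : 'rV[R]_n) : 0 <= enorm x.
Proof. exact: sqrtr_ge0. Qed.

Lemma coord_le_enorm (R : realType) n (x : 'rV[R]_n) i : `|x ord0 i| <= enorm x.
Proof.
rewrite -sqrtr_sqr ler_wsqrtr// (bigD1 i)//= lerDl.
by apply: sumr_ge0 => j _; exact: sqr_ge0.
Qed.

Lemma enorm_gt0 (R : realType) n (x : 'rV[R]_n) : x != 0 -> 0 < enorm x.
Proof.
move=> x0; rewrite lt_neqAle enorm_ge0 andbT eq_sym; apply: contra x0 => /eqP e0.
apply/eqP/rowP => i; rewrite mxE; apply/normr0_eq0/eqP.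
by rewrite -normr_le0 normr_id -e0 coord_le_enorm.
Qed.

Lemma sqnorm_gt0 (R : realType) n (x : 'rV[R]_n) : x != 0 -> 0 < sqnorm x.
Proof. by move=> x0; rewrite -enorm_sq exprn_gt0// enorm_gt0. Qed.

Lemma enorm0 (R : realType) n : enorm (0 : 'rV[R]_n) = 0.
Proof.
by rewrite /enorm big1 ?sqrtr0// => i _; rewrite mxE expr0n.
Qed.

Lemma continuous_at_sum (R : realType) (T : topologicalType) n (F : 'I_n -> T -> R) x :
  (forall i, {for x, continuous (F i)}) ->
  {for x, continuous (fun y => \sum_(i < n) F i y)}.
Proof.
elim: n F => [|n IHn] F cF.
  rewrite (_ : (fun _ => _) = cst 0); first exact: cst_continuous.
  by apply/funext => y; rewrite big_ord0.
rewrite (_ : (fun _ => _) = (fun y => (\sum_(i < n) F (widen_ord (leqnSn n) i) y) +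
  F ord_max y)); last by apply/funext => y; rewrite big_ord_recr.
by apply: continuousD; [apply: IHn => i; exact: cF|exact: cF].
Qed.

Lemma sqnorm_continuous (R : realType) n : continuous (@sqnorm R n).
Proof.
move=> x; apply: continuous_at_sum => i.
rewrite (_ : (fun y : 'rV[R]_n => _) =
  (fun y : 'rV[R]_n => y ord0 i) * (fun y : 'rV[R]_n => y ord0 i)).
  by apply: continuousM; exact: continuous_coord.
by apply/funext => y; rewrite expr2.
Qed.

Lemma enorm_continuous (R : realType) n : continuous (@enorm R n).
Proof.
by move=> x; apply: (@continuous_comp _ _ _ (@sqnorm R n) Num.sqrt);
  [exact: sqnorm_continuous|exact: sqrt_continuous].
Qed.

Lemma is_derive_sqnorm (R : realType) n (x : 'rV[R]_n) (i : 'I_n) :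
  is_derive x (delta_mx 0 i : 'rV[R]_n) (@sqnorm R n) (2 * x ord0 i).
Proof.
rewrite (_ : @sqnorm R n = \sum_(j < n) (fun y : 'rV[R]_n => y ord0 j) ^+ 2); last first.
  by apply/funext => y; rewrite fct_sumE.
apply: is_derive_eq.
  by apply: is_derive_sum => j; apply: is_deriveX; exact: is_derive_coord.
rewrite (bigD1 i)//= big1 => [|j /negPf ji]; last by rewrite ji scaler0.
by rewrite eqxx addr0 /GRing.scale/= mulr1 expr1.
Qed.

Lemma is_derive_enorm (R : realType) n (x : 'rV[R]_n) (i : 'I_n) : x != 0 ->
  is_derive x (delta_mx 0 i : 'rV[R]_n) (@enorm R n) (x ord0 i / enorm x).
Proof.
move=> x0; have S0 := sqnorm_gt0 x0.
have := is_derive_chain (is_derive_sqnorm x i) (is_derive1_sqrt S0).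
move=> H; apply: (is_derive_eq H); rewrite -/(enorm x).
by have := enorm_gt0 x0; rewrite /enorm -/(sqnorm x) => /lt0r_neq0 ?; field.
Qed.

Lemma enormV_continuous (R : realType) n (x : 'rV[R]_n) : x != 0 ->
  {for x, continuous (fun y => (@enorm R n y)^-1)}.
Proof.
move=> x0; apply: (@continuousV _ _ (@enorm R n) x); last exact: enorm_continuous.
by rewrite gt_eqF// enorm_gt0.
Qed.

Section weak_derivatives.
Variables (R : realType) (n : nat).
Implicit Types (u phi : 'rV[R]_n.+1 -> R) (g : 'rV[R]_n.+1 -> 'rV[R]_n.+1).

Lemma L1loc_off0 u : (forall x, x != 0 -> {for x, continuous u}) -> L1loc u.
Proof.
move=> cu; have mu := meas_continuous_off0 cu; split => // K cK K0.
have mK : measurable (@toRV R n.+1 @^-1` K).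
  rewrite -[X in measurable X]setCK; apply: measurableC.
  apply: (@measurable_toRV_open _ _ (~` K)); rewrite openC.
  exact: compact_rV_closed.
have memK y : (y \in @toRV R n.+1 @^-1` K) = (@toRV R n.+1 y \in K).
  by apply/idP/idP => /set_mem ?; exact/mem_set.
have [B uB] := continuous_off0_bounded cK K0 cu.
rewrite integrable_mkcond//.
have -> : ((fun y => (u (@toRV R n.+1 y))%:E) \_ (@toRV R n.+1 @^-1` K))%E =
    (fun y => ((u \_ K) (@toRV R n.+1 y))%:E).
  by apply/funext => y; rewrite !patchE memK; case: ifP.
apply: (integrable_off0 cK (D := u \_ K)).
- rewrite /meas (_ : _ \o _ = (u \o @toRV R n.+1) \_ (@toRV R n.+1 @^-1` K)); last first.
    by apply/funext => y /=; rewrite !patchE memK.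
  by apply/(measurable_restrictT _ mK); exact: measurable_funTS.
- by exists B => x Kx; rewrite patchE mem_set// uB.
- by move=> x nKx; rewrite patchE memNset.
Qed.

Lemma testfunP phi : testfun phi -> exists K : set 'rV[R]_n.+1, [/\ compact K, ~ K 0,
  forall x, ~ K x -> phi x = 0 & forall i,
  [/\ forall x, ~ K x -> partial i phi x = 0,
      continuous phi, continuous (partial i phi) &
      forall x, is_derive x (delta_mx 0 i : 'rV[R]_n.+1) phi (partial i phi x)]].
Proof.
move=> [/(_ 1%N)[cphi [dphi cdphi]] [K [cK K0 phi0]]]; exists K; split => // i.
split => // x nKx; apply: (@derive_val _ _ _ _ _ phi).
exact: is_derive_notin nKx.
Qed.

Lemma wgrad_c1 u g : c1_off0 u g -> wgrad u g.
Proof.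
move=> ug i; split.
  by apply: L1loc_off0 => x x0; have [_ + _] := ug x x0; apply.
move=> phi /testfunP[K [cK K0 phi0 /(_ i)[dphi0 cphi cdphi dphi]]].
apply: (integration_by_parts_off0 cK K0 phi0 dphi0) => x x0; split => //.
- by have [] := ug x x0.
- by have [_ + _] := ug x x0; apply.
- by have [_ _ +] := ug x x0; apply.
- exact: cphi.
- exact: cdphi.
Qed.

Definition radial_part g (x : 'rV[R]_n.+1) : R :=
  \sum_(i < n.+1) g x ord0 i * (x ord0 i / enorm x).

Let unit_coord (i : 'I_n.+1) (x : 'rV[R]_n.+1) : R := x ord0 i / enorm x.

(* The i-th partial derivative of x_i / |x|. *)
Let dunit_coord (i : 'I_n.+1) (x : 'rV[R]_n.+1) : R :=
  - x ord0 i * (x ord0 i / enorm x) * (enorm x)^-1 * (enorm x)^-1 + (enorm x)^-1.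

Lemma unit_coord_continuous i x : x != 0 -> {for x, continuous (unit_coord i)}.
Proof.
move=> x0; apply: (@continuousM _ _ (fun y : 'rV[R]_n.+1 => y ord0 i) (fun y => (enorm y)^-1)).
  exact: continuous_coord.
exact: enormV_continuous.
Qed.

Lemma dunit_coord_continuous i x : x != 0 -> {for x, continuous (dunit_coord i)}.
Proof.
move=> x0; have ci := @continuous_coord R _ i x; have ce := enormV_continuous x0.
apply: continuousD; last exact: ce.
apply: continuousM; last exact: ce.
apply: continuousM; last exact: ce.
apply: continuousM; last exact: unit_coord_continuous.
by apply: continuousN; exact: ci.
Qed.

Lemma is_derive_unit_coord i x : x != 0 ->
  is_derive x (delta_mx 0 i : 'rV[R]_n.+1) (unit_coord i) (dunit_coord i x).
Proof.
move=> x0; have e0 : enorm x != 0 by rewrite gt_eqF// enorm_gt0.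
have dinv := @is_deriveV _ id (enorm x) _ _ e0 (is_derive_id (enorm x) 1).
have H := is_deriveM (is_derive_coord x i i) (is_derive_chain (is_derive_enorm i x0) dinv).
apply: (is_derive_eq H); rewrite eqxx /GRing.scale/= /dunit_coord.
by field.
Qed.

Lemma c1_off0_radial_continuous u g x : c1_off0 u g -> x != 0 ->
  {for x, continuous (radial_part g)}.
Proof.
move=> ug x0; apply: continuous_at_sum => i.
apply: continuousM; last exact: unit_coord_continuous.
by have [_ + _] := ug x x0; apply.
Qed.

Lemma wrad_c1 u g : c1_off0 u g -> wrad u (radial_part g).
Proof.
move=> ug; split.
  by apply: L1loc_off0 => x x0; exact: c1_off0_radial_continuous ug x0.
move=> phi /testfunP[K [cK K0 phi0 Hphi]].
have psi0 i x : ~ K x -> phi x * unit_coord i x = 0 by move=> /phi0 ->; rewrite mul0r.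
pose dpsi i x := phi x * dunit_coord i x + unit_coord i x * partial i phi x.
have dpsi0 i x : ~ K x -> dpsi i x = 0.
  by move=> nKx; have [dphi0 _ _ _] := Hphi i; rewrite /dpsi phi0// dphi0// mul0r mulr0 addr0.
have dpsiE i x : x != 0 -> is_derive x (delta_mx 0 i : 'rV[R]_n.+1)
    (fun y => phi y * unit_coord i y) (dpsi i x).
  move=> x0; have [_ _ _ /(_ x) dphi] := Hphi i.
  exact: (is_deriveM dphi (is_derive_unit_coord i x0)).
have E i : partial i (fun y => phi y * y ord0 i / enorm y) = dpsi i.
  rewrite (_ : (fun y => _) = (fun y => phi y * unit_coord i y)); last first.
    by apply/funext => y; rewrite /unit_coord mulrA.
  apply/funext => x; apply: derive_val.
  (* At the origin x_i / |x| is not differentiable, but [phi] vanishes in a neighbourhood and so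
     does the product. *)
  have [->|x0] := eqVneq x 0; last exact: dpsiE.
  by rewrite dpsi0//; apply: (is_derive_notin cK) => // y; exact: psi0.
have cg i x : x != 0 -> {for x, continuous (fun y => g y ord0 i)}.
  by move=> x0; have [_ + _] := ug x x0; apply.
have ibp i : intRN (fun x => u x * dpsi i x) =
    (- intRN (fun x => (g x ord0 i * (phi x * unit_coord i x))%R))%E.
  have [_ cphi cdphi _] := Hphi i.
  apply: (integration_by_parts_off0 cK K0 (psi0 i) (dpsi0 i)) => x x0; split.
  - by have [] := ug x x0.
  - exact: cg.
  - by have [_ _ +] := ug x x0; apply.
  - by apply: continuousM; [exact: cphi|exact: unit_coord_continuous].
  - apply: continuousD; apply: continuousM; [exact: cphi|exact: dunit_coord_continuous
      |exact: unit_coord_continuous|exact: cdphi].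
  - exact: dpsiE.
have int i : (mmu (lebS R n)).-integrable setT (fun y =>
    (g (@toRV R n.+1 y) ord0 i * (phi (@toRV R n.+1 y) * unit_coord i (@toRV R n.+1 y)))%:E).
  apply: (integrable_continuous_off0 cK K0
    (D := fun x => g x ord0 i * (phi x * unit_coord i x))) => x.
    move=> x0; have [_ cphi _ _] := Hphi i; apply: continuousM; first exact: cg.
    by apply: continuousM; [exact: cphi|exact: unit_coord_continuous].
  by move=> nKx; rewrite psi0// mulr0.
(* The integrals are finite; passing to real numbers allows the sign to be taken out of the sum. *)
under eq_bigr do rewrite E ibp /intRN -(fineK (integrable_fin_num _ (int _)))// -EFinN.
rewrite sumEFin -EFinN sumrN opprK -sumEFin.
under [RHS]eq_bigr do rewrite fineK ?integrable_fin_num//.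
rewrite -integral_sum//; apply: eq_integral => y _; rewrite sumEFin; congr EFin.
rewrite /radial_part mulr_suml; apply: eq_bigr => i _; rewrite /unit_coord; ring.
Qed.

End weak_derivatives.

(** * Weighted norms and logarithmic shells *)

Lemma powR_inv_scale (R : realType) (m p y z : R) : 0 < p -> 0 <= y -> 0 <= z -> 0 <= m ->
  z <= m `^ p * y -> z `^ p^-1 <= m * y `^ p^-1.
Proof.
move=> p0 y0 z0 m0 zy; have p1 : 0 <= p^-1 by rewrite invr_ge0 ltW.
have -> : m * y `^ p^-1 = (m `^ p * y) `^ p^-1.
  by rewrite powRM ?powR_ge0// -powRrM mulfV ?gt_eqF// powRr1.
by rewrite ge0_ler_powR// nnegrE mulr_ge0// powR_ge0.
Qed.

Section weighted_integrals.
Variables (R : realType) (n : nat).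
Implicit Types (u : 'rV[R]_n.+1 -> R) (g : 'rV[R]_n.+1 -> 'rV[R]_n.+1).

Lemma wint_ge0 d s u : (0 <= wint d s u)%E.
Proof. by apply: integral_ge0 => y _; rewrite lee_fin mulr_ge0// powR_ge0. Qed.

Lemma meas_weighted d s u : meas u ->
  meas (fun x => (enorm x) `^ d * `|u x| `^ s).
Proof.
move=> mu; apply: measurable_funM.
  apply: (measurableT_comp (measurable_powR d)).
  by apply: (@meas_continuous_off0 _ _ (@enorm R n.+1)) => x _; exact: enorm_continuous.
apply: (measurableT_comp (measurable_powR s)).
exact: measurableT_comp.
Qed.

(** A crude substitute for Cauchy-Schwarz: each of the N terms is at most |g|. The factor N only
    affects constants. *)
Lemma radial_part_le g x : `|radial_part g x| <= n.+1%:R * enorm (g x).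
Proof.
apply: le_trans (ler_norm_sum _ _ _) _.
rewrite (_ : _ * _ = \sum_(i < n.+1) enorm (g x)); last first.
  by rewrite sumr_const card_ord mulr_natl.
apply: ler_sum => i _.
have [->|x0] := eqVneq x 0.
  by rewrite mxE mul0r mulr0 normr0 enorm_ge0.
rewrite normrM -[leRHS]mulr1 ler_pM//; first exact: coord_le_enorm.
rewrite normrM normfV (ger0_norm (enorm_ge0 x)) ler_pdivrMr ?enorm_gt0// mul1r.
exact: coord_le_enorm.
Qed.

Lemma wint_radial_part_le d s u g : c1_off0 u g -> 0 < s ->
  (wint d s (radial_part g) <=
   (n.+1%:R `^ s)%:E * wint d s (fun x => enorm (g x)))%E.
Proof.
move=> ug s0; have mg : meas (fun x => enorm (g x)).
  apply: meas_continuous_off0 => x x0; apply: continuous_comp; last exact: enorm_continuous.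
  by apply: continuous_mx => i; have [_ + _] := ug x x0; apply.
have mh : meas (radial_part g).
  by apply: meas_continuous_off0 => x x0; exact: c1_off0_radial_continuous ug x0.
rewrite /wint /intRN -ge0_integralZl//.
- apply: ge0_le_integral => //.
  + by move=> y _; rewrite lee_fin mulr_ge0// powR_ge0.
  + by apply/measurable_EFinP; exact: (meas_weighted d s mh).
  + apply/measurable_EFinP; apply: measurable_funM => //.
    exact: (meas_weighted d s mg).
  + move=> y _; rewrite -EFinM lee_fin mulrCA ler_wpM2l ?powR_ge0//.
    rewrite -powRM ?enorm_ge0// (ger0_norm (enorm_ge0 _)).
    rewrite ge0_ler_powR// ?nnegrE ?mulr_ge0 ?enorm_ge0 ?(ltW s0)//.
    exact: radial_part_le.
- by apply/measurable_EFinP; exact: (meas_weighted d s mg).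
- by move=> y _; rewrite lee_fin mulr_ge0// powR_ge0.
Qed.

Lemma inW_c1 a b q p u g : c1_off0 u g -> (wint a q u < +oo)%E ->
  (wint b p (fun x => enorm (g x)) < +oo)%E -> inW a b q p u g.
Proof.
move=> ug uq gp; have cu x : x != 0 -> {for x, continuous u} by move=> /ug[].
split; [exact: L1loc_off0|exact: wgrad_c1| |].
- by split => //; exact: meas_continuous_off0.
- split => //; apply: meas_continuous_off0 => x x0.
  apply: continuous_comp; last exact: enorm_continuous.
  by apply: continuous_mx => i; have [_ + _] := ug x x0; apply.
Qed.

Lemma inWt_c1 a b q p u g : 0 < p -> c1_off0 u g -> (wint a q u < +oo)%E ->
  (wint b p (fun x => enorm (g x)) < +oo)%E -> inWt a b q p u (radial_part g).
Proof.
move=> p0 ug uq gp; have cu x : x != 0 -> {for x, continuous u} by move=> /ug[].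
split; [exact: L1loc_off0|exact: wrad_c1| |].
- by split => //; exact: meas_continuous_off0.
- split; first by apply: meas_continuous_off0 => x x0; exact: c1_off0_radial_continuous ug x0.
  apply: le_lt_trans (wint_radial_part_le b ug p0) _.
  by rewrite lte_mul_pinfty// lee_fin powR_ge0.
Qed.

(** One witness settles both spaces, because its radial derivative is dominated by its gradient. *)
Lemma not_sub_L a b q p c r u g : 0 < p -> c1_off0 u g -> (wint a q u < +oo)%E ->
  (wint b p (fun x => enorm (g x)) < +oo)%E -> wint c r u = +oo%E ->
  ~ W_sub_L n.+1 a b q p c r /\ ~ Wt_sub_L n.+1 a b q p c r.
Proof.
move=> p0 ug uq gp uc; split => [/(_ u g (inW_c1 ug uq gp))|
  /(_ u (radial_part g) (inWt_c1 p0 ug uq gp))] []; by rewrite uc.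
Qed.

(* The common consequence of the two continuous embeddings, for C^1 functions:
   the radial derivative is bounded by N times the gradient. *)
Definition c1_emb_L (a b q p c r C : R) : Prop :=
  forall u g, c1_off0 u g -> (wint a q u < +oo)%E ->
    (wint b p (fun x => enorm (g x)) < +oo)%E -> (wint c r u < +oo)%E /\
    wnorm c r u <= C * (wnorm a q u + wnorm b p (fun x => enorm (g x))).

Lemma wnorm_ge0 d s u : 0 <= wnorm d s u.
Proof. exact: powR_ge0. Qed.

Lemma W_emb_c1 a b q p c r : W_emb_L n.+1 a b q p c r ->
  exists2 C, 0 <= C & c1_emb_L a b q p c r C.
Proof.
move=> [sub [C emb]]; exists `|C|; [exact: normr_ge0|move=> u g ug uq gp].
have ugW := inW_c1 ug uq gp; split; first by have [] := sub _ _ ugW.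
by rewrite (le_trans (emb _ _ ugW))// ler_wpM2r ?ler_norm// addr_ge0// wnorm_ge0.
Qed.

Lemma Wt_emb_c1 a b q p c r : 0 < p -> Wt_emb_L n.+1 a b q p c r ->
  exists2 C, 0 <= C & c1_emb_L a b q p c r C.
Proof.
move=> p0 [sub [C emb]]; exists (`|C| * n.+1%:R); first by rewrite mulr_ge0.
move=> u g ug uq gp.
have ugW := inWt_c1 p0 ug uq gp; split; first by have [] := sub _ _ ugW.
apply: le_trans (emb _ _ ugW) _.
apply: (@le_trans _ _ (`|C| * (wnorm a q u + wnorm b p (radial_part g)))).
  by apply: ler_wpM2r; [rewrite addr_ge0// wnorm_ge0|exact: ler_norm].
rewrite -(mulrA `|C|); apply: ler_wpM2l => //; rewrite mulrDr; apply: lerD.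
  by rewrite ler_peMl ?wnorm_ge0// ler1n.
have h := wint_radial_part_le b ug p0.
have gfin : wint b p (fun x => enorm (g x)) \is a fin_num.
  by rewrite ge0_fin_numE// wint_ge0.
rewrite -(fineK gfin) -EFinM in h.
have hfin : wint b p (radial_part g) \is a fin_num.
  by rewrite (ge0_fin_numE (wint_ge0 _ _ _)); exact: le_lt_trans h (ltry _).
move: h; rewrite -(fineK hfin) lee_fin => h.
exact: (powR_inv_scale p0 (fine_ge0 (wint_ge0 _ _ _)) (fine_ge0 (wint_ge0 _ _ _)) (ler0n _ _) h).
Qed.

End weighted_integrals.

(** * Power sums and the measure of logarithmic shells *)

Lemma powRE (R : realType) (x d : R) : 0 < x -> x `^ d = expR (d * ln x).
Proof. by move=> x0; rewrite /powR gt_eqF. Qed.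

(* Telescoping: with e = theta - 1, (k+2)^(-theta) is at most the increment of
   -x^(-e) / e over [k+1, k+2]. *)
Lemma sum_powRN_le (R : realType) (theta : R) (n : nat) : 1 < theta ->
  \sum_(0 <= k < n) (k.+1%:R : R) `^ (- theta) <= 1 + (theta - 1)^-1.
Proof.
move=> t1; set e := theta - 1; have e0 : 0 < e by rewrite subr_gt0.
have step (k : nat) : (k.+2%:R : R) `^ (- theta) <=
    e^-1 * ((k.+1%:R : R) `^ (- e) - (k.+2%:R : R) `^ (- e)).
  set x : R := k.+1%:R; set y : R := k.+2%:R.
  have x0 : 0 < x by rewrite ltr0n.
  have y0 : 0 < y by rewrite ltr0n.
  have yx : y = x + 1 by rewrite /y /x -natr1.
  have -> : y `^ (- theta) = y `^ (- e) * y^-1.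
    rewrite -powR_inv1 ?(ltW y0)// -powRD ?(gt_eqF y0) ?implybT//.
    by congr (_ `^ _); rewrite /e; lra.
  have -> : x `^ (- e) = y `^ (- e) * expR (e * (ln y - ln x)).
    by rewrite !powRE// -expRD; congr expR; ring.
  rewrite ler_pdivlMl//.
  (* Combines exp v >= 1 + v with ln (y / x) >= 1 - x / y = 1 / y, the latter because y - x = 1. *)
  have H : e * y^-1 <= expR (e * (ln y - ln x)) - 1.
    apply: (@le_trans _ _ (e * (ln y - ln x))); last first.
      by rewrite lerBrDl expR_ge1Dx.
    rewrite ler_pM2l// -lerN2 opprB -ln_div ?posrE//.
    apply: (@le_trans _ _ (x / y - 1)).
      have := @le_ln1Dx R (x / y - 1); rewrite addrCA subrr addr0; apply.
      by rewrite ltrBrDl subrr divr_gt0.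
    have -> : x = y - 1 by rewrite yx addrK.
    by rewrite mulrBl mulfV ?gt_eqF// mul1r addrAC subrr add0r.
  have p0 := powR_ge0 y (- e).
  have := ler_wpM2l p0 H; rewrite mulrBr mulr1 => /(le_trans _); apply.
  by rewrite mulrCA.
have main m : \sum_(0 <= k < m.+1) (k.+1%:R : R) `^ (- theta) <=
    1 + e^-1 * (1 - (m.+1%:R : R) `^ (- e)).
  elim: m => [|m IHm]; first by rewrite big_nat1 powR1 subrr mulr0 addr0.
  rewrite big_nat_recr//= (le_trans (lerD IHm (step m)))//.
  by rewrite -addrA -mulrDr addrA subrK.
case: n => [|m]; first by rewrite big_geq// addr_ge0// invr_ge0 ltW.
rewrite (le_trans (main m))// lerD2l -[leRHS]mulr1 ler_wpM2l ?invr_ge0 ?(ltW e0)//.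
Qed.

Lemma harmonic_sum_unbounded (R : realType) (B : R) :
  exists n, B < \sum_(0 <= k < n) (k.+1%:R : R)^-1.
Proof.
apply: contrapT => /forallNP H; apply: (@dvg_harmonic R).
apply: nondecreasing_is_cvgn.
  by apply: nondecreasing_series => k _ _; rewrite /= invr_ge0.
exists B => _ [n _ <-]; rewrite leNgt; apply/negP; exact: H.
Qed.

Section shells.
Variables (R : realType) (n : nat).

(* The origin lies in [shell sgm 0], because ln 0 = 0. *)
Definition shell (sgm : R) (k : nat) : set (mT (lebS R n)) :=
  [set y | k%:R <= sgm * ln (enorm (@toRV R n.+1 y)) < k.+1%:R].

Lemma measurable_shell sgm k : measurable (shell sgm k).
Proof.
have mf : measurable_fun setT (fun y => sgm * ln (enorm (@toRV R n.+1 y))).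
  apply: measurable_funM => //; apply: (measurableT_comp (@measurable_ln R)).
  by apply: (@meas_continuous_off0 _ _ (@enorm R n.+1)) => x _; exact: enorm_continuous.
have := mf measurableT `[k%:R, k.+1%:R[%classic (measurable_itv _).
by rewrite setTI; congr measurable; apply/seteqP; split => y /=; rewrite in_itv.
Qed.

Lemma trivIset_shell sgm : trivIset setT (shell sgm).
Proof.
apply/trivIsetP => i j _ _ /eqP ij; apply/seteqP; split => // y [] /=.
move=> /andP[i1 i2] /andP[j1 j2]; apply: ij; apply/eqP; rewrite eqn_leq.
have := le_lt_trans i1 j2; have := le_lt_trans j1 i2.
by rewrite !ltr_nat !ltnS => -> ->.
Qed.

(** The shell lies between two cubes, which replaces polar coordinates. Inside it is the cube with
    coordinates from e^L / sqrt N to e^(L+1) / sqrt N, whose points have norm between e^L and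
    e^(L+1); around it is the centred cube of half-side e^(sgm k + 1). *)
Lemma shell_bounds sgm k : (sgm = 1 \/ sgm = -1) ->
  ((((expR 1 - 1) / (expR 1 * Num.sqrt n.+1%:R)) ^+ n.+1 *
    expR (sgm * k%:R * n.+1%:R))%:E <= mmu (lebS R n) (shell sgm k))%E /\
  (mmu (lebS R n) (shell sgm k) <=
    ((2 * expR 1) ^+ n.+1 * expR (sgm * k%:R * n.+1%:R))%:E)%E.
Proof.
move=> sgm1; have sn0 : 0 < Num.sqrt (n.+1%:R : R) by rewrite sqrtr_gt0 ltr0n.
have pw (a L : R) : a ^+ n.+1 * expR (L * n.+1%:R) = (a * expR L) ^+ n.+1.
  by rewrite exprMn -expRM_natr.
have e1 : 1 < expR 1 :> R by rewrite expR_gt1.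
rewrite !pw; split.
(* [L] is k for sgm = 1 and -(k+1) for sgm = -1. The second choice costs the factor 1/e in the lower
   constant. *)
- have [L [HL1 HL2]] : exists L, expR (sgm * k%:R) <= expR 1 * expR L /\
     forall x : 'rV[R]_n.+1, expR L < enorm x < expR (L + 1) ->
       k%:R <= sgm * ln (enorm x) < k.+1%:R.
    have lnP (x : 'rV[R]_n.+1) L : expR L < enorm x < expR (L + 1) ->
        L < ln (enorm x) < L + 1.
      move=> /andP[h1 h2]; have x0 : 0 < enorm x by apply: lt_trans h1; exact: expR_gt0.
      by rewrite -ltr_expR lnK ?posrE// h1 -ltr_expR lnK ?posrE// h2.
    case: sgm1 => ->.
      exists k%:R; rewrite mul1r -expRD ler_expR; split => [|x /lnP /andP[h1 h2]]; first lra.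
      by rewrite mul1r (ltW h1) -natr1 h2.
    exists (- k.+1%:R); rewrite mulN1r -expRD ler_expR -natr1.
    split => [|x /lnP /andP[h1 h2]]; first lra.
    by rewrite mulN1r; apply/andP; split; lra.
  pose s := Num.sqrt (n.+1%:R : R).
  have lh : expR L / s < expR (L + 1) / s by rewrite ltr_pM2r ?invr_gt0// ltr_expR ltrDl.
  apply: (@le_trans _ _ (mmu (lebS R n) (cube (expR L / s) (expR (L + 1) / s)))).
    rewrite measure_cube// lee_fin lerXn2r ?nnegrE//.
    + by rewrite subr_ge0 ltW.
    + rewrite expRD -mulrBl -/s.
      rewrite [leLHS](_ : _ = (expR 1 - 1) / s * (expR (sgm * k%:R) / expR 1)); last first.
        have := expR_gt0 (1 : R) => /lt0r_neq0 ?; have := lt0r_neq0 sn0; rewrite -/s => ?.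
        by field; apply/andP.
      rewrite [leRHS](_ : _ = (expR 1 - 1) / s * expR L); last by ring.
      rewrite ler_wpM2l// ?divr_ge0 ?subr_ge0 ?(ltW e1) ?(ltW sn0)//.
      by rewrite ler_pdivrMr ?expR_gt0// [leRHS]mulrC.
  apply: le_measure; rewrite ?inE; [exact: measurable_cube|exact: measurable_shell|].
  move=> y cy; apply: HL2.
  have S1 (c : R) : 0 <= c -> Num.sqrt (\sum_(i < n.+1) (c / s) ^+ 2) = c.
    move=> c0; rewrite /s sumr_const card_ord expr_div_n sqr_sqrtr ?ler0n//.
    by rewrite -[X in Num.sqrt X]mulr_natr divfK ?pnatr_eq0// sqrtr_sqr ger0_norm.
  rewrite -[X in X < _ < _](S1 _ (expR_ge0 _)) -[X in _ < _ < X](S1 _ (expR_ge0 _)).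
  have cc i : (expR L / s) ^+ 2 < (@toRV R n.+1 y) ord0 i ^+ 2 < (expR (L + 1) / s) ^+ 2.
    rewrite toRVE; have /andP[c1 c2] := cy i.
    have l0 : 0 <= expR L / s by rewrite divr_ge0 ?expR_ge0// ltW.
    have y0 := ltW (le_lt_trans l0 c1).
    by rewrite !ltrXn2r ?nnegrE// (le_trans y0 (ltW c2)).
  have i0 : 'I_n.+1 := ord0.
  apply/andP; split; rewrite ltr_sqrt.
  + rewrite ltr_sum//; first by apply/hasP; exists i0; rewrite ?mem_index_enum.
    by move=> i _; have /andP[] := cc i.
  + apply: lt_le_trans (_ : 0 < (@toRV R n.+1 y) ord0 i0 ^+ 2) _.
      by have /andP[h _] := cc i0; apply: le_lt_trans h; exact: sqr_ge0.
    by rewrite (bigD1 i0)//= lerDl; apply: sumr_ge0 => j _; exact: sqr_ge0.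
  + rewrite ltr_sum//; first by apply/hasP; exists i0; rewrite ?mem_index_enum.
    by move=> i _; have /andP[] := cc i.
  + rewrite sumr_const card_ord -mulr_natr mulr_gt0// exprn_gt0//.
    by rewrite divr_gt0 ?expR_gt0.
- pose h := expR 1 * expR (sgm * k%:R).
  have h0 : 0 < h by rewrite mulr_gt0 ?expR_gt0.
  apply: (@le_trans _ _ (mmu (lebS R n) (cube (- h) h))); last first.
    by rewrite measure_cube ?gtrN// lee_fin opprK -mulrA -/h mulr2n mulrDl mul1r.
  apply: le_measure; rewrite ?inE; [exact: measurable_shell|exact: measurable_cube|].
  move=> y /= /andP[y1 y2] i; rewrite -ltr_norml -toRVE.
  apply: le_lt_trans (coord_le_enorm _ _) _.
  have [->//|x0] := eqVneq (enorm (@toRV R n.+1 y)) 0.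
  have {}x0 : 0 < enorm (@toRV R n.+1 y) by rewrite lt0r x0 enorm_ge0.
  rewrite -[ltLHS]lnK ?posrE// /h -expRD ltr_expR.
  move: y1 y2; rewrite -natr1; case: sgm1 => ->; lra.
Qed.

End shells.

Section shell_integrals.
Variables (R : realType) (n : nat).
Implicit Types (u : 'rV[R]_n.+1 -> R) (sgm : R).

Lemma ge0_powRN_le (x y theta : R) : 0 < x -> x <= y -> 0 <= theta ->
  y `^ (- theta) <= x `^ (- theta).
Proof.
move=> x0 xy t0; have y0 := lt_le_trans x0 xy.
by rewrite !powRN lef_pV2 ?posrE ?powR_gt0// ge0_ler_powR// nnegrE ltW.
Qed.

(** The factor |x|^(-N) compensates the measure of each shell up to a constant, so the integral is
    dominated by the sum of (k+1)^(-theta). *)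
Lemma wint_lty sgm d s u C theta : (sgm = 1 \/ sgm = -1) -> meas u -> 0 < s ->
  u 0 = 0 -> (forall x, x != 0 -> sgm * ln (enorm x) < 0 -> u x = 0) ->
  0 <= C -> 1 < theta ->
  (forall x, x != 0 -> 0 <= sgm * ln (enorm x) ->
    enorm x `^ d * `|u x| `^ s <=
    C * expR (- (n.+1%:R * ln (enorm x))) * (1 + sgm * ln (enorm x)) `^ (- theta)) ->
  (wint d s u < +oo)%E.
Proof.
move=> sgm1 mu s0 u0 uneg C0 t1 bnd.
pose f (y : mT (lebS R n)) : \bar R :=
  ((enorm (@toRV R n.+1 y)) `^ d * `|u (@toRV R n.+1 y)| `^ s)%:E.
have f0 y : (0 <= f y)%E by rewrite lee_fin mulr_ge0// powR_ge0.
have fz y : u (@toRV R n.+1 y) = 0 -> f y = 0%E.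
  by move=> uy; rewrite /f uy normr0 powR0 ?mulr0// gt_eqF.
have mf : measurable_fun setT f by apply/measurable_EFinP; exact: meas_weighted.
pose Sh := @shell R n sgm.
have -> : wint d s u = (\int[mmu (lebS R n)]_(y in \bigcup_k Sh k) f y)%E.
  rewrite [RHS]integral_mkcond; apply: eq_integral => y _; rewrite patchE.
  case: ifPn => // /negP yS; apply: fz.
  have [->//|x0] := eqVneq (@toRV R n.+1 y) 0.
  apply: uneg => //; rewrite ltNge; apply/negP => t0; apply: yS.
  rewrite inE; exists (Num.truncn (sgm * ln (enorm (@toRV R n.+1 y)))) => //.
  exact: truncn_itv.
have mSh k : measurable (Sh k) := @measurable_shell R n sgm k.
rewrite ge0_integral_bigcup//; [|exact: measurable_funTS|exact: trivIset_shell].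
pose A : R := C * expR n.+1%:R * (2 * expR 1) ^+ n.+1.
have A0 : 0 <= A by rewrite !mulr_ge0 ?expR_ge0// exprn_ge0// mulr_ge0// expR_ge0.
have term k : (\int[mmu (lebS R n)]_(y in Sh k) f y <=
    (A * (k.+1%:R : R) `^ (- theta))%:E)%E.
  (* A bound for the integrand on the k-th shell: e^N absorbs the unit variation of ln |x| across
     it, and e^(-sgm k N) cancels against the measure. *)
  pose c : R := C * expR n.+1%:R * expR (- (sgm * k%:R * n.+1%:R)) * k.+1%:R `^ (- theta).
  have c0 : 0 <= c by rewrite !mulr_ge0 ?expR_ge0// powR_ge0.
  apply: (@le_trans _ _ (\int[mmu (lebS R n)]_(y in Sh k) (cst c%:E) y)%E).
    apply: ge0_le_integral => //; first exact: measurable_funTS.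
    move=> y /andP[y1 y2]; have [x0|x0] := eqVneq (@toRV R n.+1 y) 0.
      by rewrite fz ?x0//= lee_fin.
    rewrite lee_fin; apply: le_trans (bnd _ x0 (le_trans (ler0n _ _) y1)) _.
    apply: ler_pM; rewrite ?mulr_ge0 ?expR_ge0 ?powR_ge0//.
      rewrite -mulrA -expRD ler_wpM2l// ler_expR.
      have : sgm * sgm = 1 by case: sgm1 => ->; rewrite ?mulrNN mulr1.
      move=> ss; set l := ln _ in y1 y2 *; set t := sgm * l in y1 y2.
      have -> : l = sgm * t by rewrite mulrA ss mul1r.
      have N0 : 0 <= n.+1%:R :> R by rewrite ler0n.
      have tk : - (sgm * t) <= 1 - sgm * k%:R.
        by move: y1 y2; rewrite -natr1; case: sgm1 => ->; lra.
      by have := ler_wpM2l N0 tk; lra.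
    apply: ge0_powRN_le; rewrite ?ltr0n// ?(ltW (lt_trans _ t1))//.
    by rewrite -natr1 addrC lerD2l.
  rewrite integral_cst//.
  have [_ ub] := @shell_bounds R n sgm k sgm1.
  apply: (@le_trans _ _ (c%:E * ((2 * expR 1) ^+ n.+1 * expR (sgm * k%:R * n.+1%:R))%:E)%E).
    by rewrite lee_wpmul2l.
  rewrite -EFinM lee_fin /c /A expRN.
  have := expR_gt0 (sgm * k%:R * n.+1%:R) => /lt0r_neq0.
  move: (expR (sgm * _ * _)) => E E0.
  by rewrite le_eqVlt; apply/orP; left; apply/eqP; field.
apply: (@le_lt_trans _ _ (A * (1 + (theta - 1)^-1))%:E); last exact: ltry.
apply: lime_le.
  by apply: is_cvg_nneseries => k _ _; apply: integral_ge0.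
near=> m; apply: (@le_trans _ _ (\sum_(0 <= k < m) (A * (k.+1%:R : R) `^ (- theta))%:E)%E).
  by apply: lee_sum => k _; exact: term.
rewrite sumEFin lee_fin -mulr_sumr ler_wpM2l//.
exact: sum_powRN_le.
Unshelve. all: by end_near. Qed.

(** The same cancellation of |x|^(-N) against the shell measure now leaves a multiple of the
    harmonic series as a lower bound. *)
Lemma wint_infty sgm d s u c : (sgm = 1 \/ sgm = -1) -> meas u -> 0 < c ->
  (forall x, x != 0 -> 1 <= sgm * ln (enorm x) ->
    c * expR (- (n.+1%:R * ln (enorm x))) * (1 + sgm * ln (enorm x))^-1 <=
    enorm x `^ d * `|u x| `^ s) ->
  wint d s u = +oo%E.
Proof.
move=> sgm1 mu c0 bnd.
pose f (y : mT (lebS R n)) : \bar R :=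
  ((enorm (@toRV R n.+1 y)) `^ d * `|u (@toRV R n.+1 y)| `^ s)%:E.
have f0 y : (0 <= f y)%E by rewrite lee_fin mulr_ge0// powR_ge0.
have mf : measurable_fun setT f by apply/measurable_EFinP; exact: meas_weighted.
(* The shells are indexed from 1: the lower bound is assumed only where t >= 1, and this also leaves
   out the shell containing the origin. *)
pose Sh k := @shell R n sgm k.+1.
have mSh k : measurable (Sh k) := @measurable_shell R n sgm k.+1.
have tSh : trivIset setT Sh.
  move=> i j _ _ /(@trivIset_shell R n sgm _ _ I I); exact: succn_inj.
have lb : (\sum_(k <oo) \int[mmu (lebS R n)]_(y in Sh k) f y <= wint d s u)%E.
  rewrite -ge0_integral_bigcup//; last exact: measurable_funTS.
  apply: ge0_subset_integral => //; exact: bigcupT_measurable.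
(* The 3 comes from 1 + t < k + 3 <= 3 (k + 1) on the shell of index k + 1. *)
pose A : R := c * expR (- n.+1%:R) * ((expR 1 - 1) / (expR 1 * Num.sqrt n.+1%:R)) ^+ n.+1 / 3.
have A0 : 0 < A.
  have e1 : 1 < expR 1 :> R by rewrite expR_gt1.
  have s1 : 0 < Num.sqrt n.+1%:R :> R by rewrite sqrtr_gt0 ltr0n.
  have P0 : 0 < (expR 1 - 1) / (expR 1 * Num.sqrt n.+1%:R) :> R.
    by apply: divr_gt0; [rewrite subr_gt0|apply: mulr_gt0 => //; exact: expR_gt0].
  apply: divr_gt0 => //; apply: mulr_gt0; last exact: exprn_gt0.
  by apply: mulr_gt0 => //; exact: expR_gt0.
have term k : ((A * (k.+1%:R : R)^-1)%:E <= \int[mmu (lebS R n)]_(y in Sh k) f y)%E.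
  pose v : R := c * expR (- n.+1%:R) * expR (- (sgm * k.+1%:R * n.+1%:R)) / (3 * k.+1%:R).
  have v0 : 0 <= v by rewrite !mulr_ge0 ?expR_ge0 ?(ltW c0)// invr_ge0 mulr_ge0.
  apply: (@le_trans _ _ (\int[mmu (lebS R n)]_(y in Sh k) (cst v%:E) y)%E); last first.
    apply: ge0_le_integral => //; first exact: measurable_funTS.
    move=> y /andP[y1 y2]; have [x0|x0] := eqVneq (@toRV R n.+1 y) 0.
      by move: y1; rewrite x0 enorm0 ln0// mulr0 lern0.
    rewrite lee_fin; apply: le_trans (bnd _ x0 (le_trans _ y1)); last by rewrite ler1n.
    have k0 : 0 <= k%:R :> R by rewrite ler0n.
    apply: ler_pM; rewrite ?mulr_ge0 ?invr_ge0 ?mulr_ge0 ?expR_ge0 ?(ltW c0)//.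
      rewrite -mulrA -expRD ler_wpM2l ?(ltW c0)// ler_expR.
      have : sgm * sgm = 1 by case: sgm1 => ->; rewrite ?mulrNN mulr1.
      move=> ss; set l := ln _ in y1 y2 *; set t := sgm * l in y1 y2.
      have -> : l = sgm * t by rewrite mulrA ss mul1r.
      have N0 : 0 <= n.+1%:R :> R by rewrite ler0n.
      have tk : - 1 - sgm * k.+1%:R <= - (sgm * t).
        by move: y1 y2; rewrite -natr1; case: sgm1 => ->; lra.
      by have := ler_wpM2l N0 tk; lra.
    move: y1 y2; rewrite -!natr1 => y1 y2.
    by rewrite lef_pV2 ?posrE; lra.
  rewrite integral_cst//.
  have [ub _] := @shell_bounds R n sgm k.+1 sgm1.
  apply: le_trans (lee_wpmul2l _ ub) => //.
  rewrite -EFinM lee_fin /v /A expRN.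
  have k0 : k.+1%:R != 0 :> R by rewrite pnatr_eq0.
  have := expR_gt0 (sgm * k.+1%:R * n.+1%:R) => /lt0r_neq0.
  move: (expR (sgm * _ * _)) (_ ^+ n.+1) (expR (- _)) => E P Q E0.
  by rewrite le_eqVlt; apply/orP; left; apply/eqP; field; apply/andP.
apply/eqP; rewrite -leye_eq; apply: le_trans lb; rewrite leye_eq; apply/eqP/eq_infty => B.
have [m Bm] := harmonic_sum_unbounded (B / A).
apply: (@le_trans _ _ (\sum_(0 <= k < m) (A * (k.+1%:R : R)^-1)%:E)%E).
  by rewrite sumEFin lee_fin -mulr_sumr -ler_pdivrMl// mulrC ltW.
apply: (@le_trans _ _ (\sum_(0 <= k < m) \int[mmu (lebS R n)]_(y in Sh k) f y)%E).
  by apply: lee_sum => k _; exact: term.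
by apply: nneseries_lim_ge => k _ _; apply: integral_ge0.
Qed.

End shell_integrals.

(** * Radial functions *)

Lemma enormZ (R : realType) n (k : R) (x : 'rV[R]_n) : enorm (k *: x) = `|k| * enorm x.
Proof.
rewrite /enorm (_ : \sum_i _ = k ^+ 2 * \sum_(i < n) x ord0 i ^+ 2).
  by rewrite sqrtrM ?sqr_ge0// sqrtr_sqr.
by rewrite mulr_sumr; apply: eq_bigr => i _; rewrite mxE exprMn.
Qed.

Section radial_functions.
Variables (R : realType) (n : nat) (sgm : R).
Hypothesis sgm1 : sgm = 1 \/ sgm = -1.

Definition radial_fun (F : R -> R) (x : 'rV[R]_n.+1) : R := F (sgm * ln (enorm x)).

Definition radial_grad (dF : R -> R) (x : 'rV[R]_n.+1) : 'rV[R]_n.+1 :=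
  (sgm * dF (sgm * ln (enorm x)) * (enorm x)^-1 * (enorm x)^-1) *: x.

Lemma sgm_sqr : sgm * sgm = 1.
Proof. by case: sgm1 => ->; rewrite ?mulrNN mulr1. Qed.

Lemma log_enorm_continuous (x : 'rV[R]_n.+1) : x != 0 ->
  {for x, continuous (fun y => sgm * ln (@enorm R n.+1 y))}.
Proof.
move=> x0; apply: continuousM; first exact: cst_continuous.
apply: continuous_comp; first exact: enorm_continuous.
exact/continuous_ln/enorm_gt0.
Qed.

Lemma radial_c1 (F dF : R -> R) : (forall t, is_derive t (1 : R) F (dF t)) ->
  continuous dF -> c1_off0 (radial_fun F) (radial_grad dF).
Proof.
move=> FdF cdF x x0.
have cF : continuous F.
  by move=> t; apply/differentiable_continuous/derivable1_diffP; case: (FdF t).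
have cl := log_enorm_continuous x0.
have ce := enormV_continuous x0.
have e0 := enorm_gt0 x0.
split.
- by apply: continuous_comp cl _; exact: cF.
- move=> i; rewrite /radial_grad.
  rewrite (_ : (fun y => _) = (fun y : 'rV[R]_n.+1 =>
    sgm * dF (sgm * ln (enorm y)) * (enorm y)^-1 * (enorm y)^-1 * y ord0 i)); last first.
    by apply/funext => y; rewrite mxE.
  apply: continuousM; last exact: continuous_coord.
  apply: continuousM; last exact: ce.
  apply: continuousM; last exact: ce.
  apply: continuousM; first exact: cst_continuous.
  by apply: continuous_comp cl _; exact: cdF.
- move=> i.
  have dl := is_derive_chain (is_derive_enorm i x0) (is_derive1_ln e0).
  have ds : is_derive (ln (enorm x)) 1 (fun s : R => sgm * s) sgm.
    have H := is_deriveZ sgm (is_derive_id (ln (enorm x)) (1 : R)).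
    by apply: (is_derive_eq H); rewrite /GRing.scale/= mulr1.
  have H := is_derive_chain (is_derive_chain dl ds) (FdF (sgm * ln (enorm x))).
  apply: (is_derive_eq H); rewrite mxE.
  by have := lt0r_neq0 e0 => ?; field.
Qed.

Lemma enorm_radial_grad dF (x : 'rV[R]_n.+1) : x != 0 ->
  enorm (radial_grad dF x) = `|dF (sgm * ln (enorm x))| / enorm x.
Proof.
move=> x0; have e0 := enorm_gt0 x0.
rewrite enormZ !normrM normfV (ger0_norm (enorm_ge0 x)).
have -> : `|sgm| = 1 by case: sgm1 => ->; rewrite ?normrN normr1.
by have := lt0r_neq0 e0 => ?; field.
Qed.

(** A pointwise sufficient condition for exp(del t) Z to lie in L^s(dt) near infinity. It is stable
    under sums and domination, and suits the shell estimate directly. *)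
Definition decays (del s : R) (Z : R -> R) : Prop := exists C eta,
  [/\ 0 <= C, 1 < eta * s &
   forall t, 0 <= t -> expR (del * t) * `|Z t| <= C * (1 + t) `^ (- eta)].

(** The weight is split as |x|^(d+N) |x|^(-N): the first factor enters the exponential, which fixes
    the exponent sgm (d+N)/s, and the second cancels the volume of the shells. *)
Lemma weight_powR (X d s del t z : R) : 0 < X -> ln X = sgm * t -> 0 <= z ->
  del * s = sgm * (d + n.+1%:R) ->
  X `^ d * z `^ s = (expR (del * t) * z) `^ s * expR (- (n.+1%:R * ln X)).
Proof.
move=> X0 lX z0 ds; rewrite powRM ?expR_ge0// -expRM mulrAC -expRD powRE//.
congr (expR _ * _); rewrite -mulrA (mulrC t) mulrA ds lX; ring.
Qed.

Lemma wint_decays (d s del : R) (u : 'rV[R]_n.+1 -> R) (Z : R -> R) : meas u -> 0 < s ->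
  del * s = sgm * (d + n.+1%:R) -> u 0 = 0 ->
  (forall x, x != 0 -> sgm * ln (enorm x) < 0 -> u x = 0) ->
  (forall x, x != 0 -> 0 <= sgm * ln (enorm x) -> `|u x| = `|Z (sgm * ln (enorm x))|) ->
  decays del s Z -> (wint d s u < +oo)%E.
Proof.
move=> mu s0 ds u0 uneg uZ [C [eta [C0 eta1 bnd]]].
apply: (@wint_lty _ _ sgm d s u (C `^ s) (eta * s)) => //; first exact: powR_ge0.
move=> x x0 t0; rewrite uZ//; have e0 := enorm_gt0 x0.
set t := sgm * _ in t0 *.
have lt : ln (enorm x) = sgm * t by rewrite /t mulrA sgm_sqr mul1r.
rewrite (@weight_powR _ d s del t)// mulrAC ler_wpM2r ?expR_ge0//.
rewrite -mulNr powRrM -powRM ?powR_ge0//.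
by rewrite ge0_ler_powR ?(ltW s0)// ?nnegrE ?mulr_ge0 ?expR_ge0 ?powR_ge0// bnd.
Qed.

Lemma radial_not_sub (F dF : R -> R) (a b c p q r A0 A1 G m : R) :
  0 < p -> 0 < q -> 0 < r ->
  A0 * q = sgm * (a + n.+1%:R) -> A1 * p = sgm * (b - p + n.+1%:R) ->
  G * r = sgm * (c + n.+1%:R) ->
  (forall t, is_derive t (1 : R) F (dF t)) -> continuous dF ->
  (forall t, t <= 0 -> F t = 0 /\ dF t = 0) ->
  decays A0 q F -> decays A1 p dF -> 0 < m ->
  (forall t, 1 <= t -> m * (1 + t) `^ (- r^-1) <= expR (G * t) * `|F t|) ->
  ~ W_sub_L n.+1 a b q p c r /\ ~ Wt_sub_L n.+1 a b q p c r.
Proof.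
move=> p0 q0 r0 A0q A1p Gr FdF cdF F0 decF decdF m0 low.
have ug := radial_c1 FdF cdF.
have mu : meas (radial_fun F) by apply: meas_continuous_off0 => x x0; have [] := ug x x0.
have mg : meas (fun x => enorm (radial_grad dF x)).
  apply: meas_continuous_off0 => x x0; apply: continuous_comp; last exact: enorm_continuous.
  by apply: continuous_mx => i; have [_ + _] := ug x x0; apply.
have u0 : radial_fun F 0 = 0 by rewrite /radial_fun enorm0 ln0// mulr0 (F0 _ (lexx _)).1.
apply: (not_sub_L p0 ug).
- apply: (@wint_decays a q A0 _ F) => //.
  by move=> x _ t0; rewrite /radial_fun (F0 _ (ltW t0)).1.
(* The factor 1/|x| in the norm of the gradient turns the weight b into b - p. At the origin both
   integrands vanish, since [ln 0 = 0] and dF(0) = 0. *)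
- pose w (x : 'rV[R]_n.+1) : R := `|dF (sgm * ln (enorm x))|.
  have gw : wint b p (fun x => enorm (radial_grad dF x)) = wint (b - p) p w.
    apply: eq_integral => y _; congr EFin.
    have [->|x0] := eqVneq (@toRV R n.+1 y) 0.
      have z : (0 : R) `^ p = 0 by rewrite powR0// gt_eqF.
      rewrite /w /radial_grad scaler0 enorm0 normr0 z mulr0.
      by rewrite ln0// mulr0 (F0 _ (lexx _)).2 !normr0 z mulr0.
    have e0 := enorm_gt0 x0; rewrite enorm_radial_grad// /w normr_id normrM normfV.
    rewrite normr_id (ger0_norm (enorm_ge0 _)).
    rewrite powRM ?invr_ge0 ?enorm_ge0// -powR_inv1 ?enorm_ge0// -powRrM mulN1r.
    by rewrite mulrCA -powRD ?(gt_eqF e0) ?implybT// mulrC.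
  rewrite {}gw; apply: (@wint_decays (b - p) p A1 _ dF) => //.
  + apply: meas_continuous_off0 => x x0; apply: continuous_comp; last exact: norm_continuous.
    apply: continuous_comp; [exact: log_enorm_continuous|exact: cdF].
  + by rewrite /w enorm0 ln0// mulr0 (F0 _ (lexx _)).2 normr0.
  + by move=> x _ t0; rewrite /w (F0 _ (ltW t0)).2 normr0.
  + by move=> x _ _; rewrite /w normr_id.
- apply: (@wint_infty _ _ sgm c r _ (m `^ r)) => //; first exact: powR_gt0.
  move=> x x0 t1; have e0 := enorm_gt0 x0; rewrite /radial_fun.
  set t := sgm * _ in t1 *.
  have lt : ln (enorm x) = sgm * t by rewrite /t mulrA sgm_sqr mul1r.
  rewrite (@weight_powR _ c r G t)// mulrAC ler_wpM2r ?expR_ge0//.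
  have t2 : 0 < 1 + t by lra.
  rewrite -[X in _ * X](_ : ((1 + t) `^ (- r^-1)) `^ r = _); last first.
    by rewrite -powRrM mulNr mulVf ?gt_eqF// powR_inv1// ltW.
  rewrite -powRM ?powR_ge0 ?(ltW m0)//.
  by rewrite ge0_ler_powR ?(ltW r0)// ?nnegrE ?mulr_ge0 ?expR_ge0 ?powR_ge0 ?(ltW m0)// low.
Qed.

End radial_functions.

(** * The C^1 cut-off and the decaying profiles *)

(** Squaring the positive part removes its kink: the derivative 2 max(0, s) is continuous, which is
    all the regularity needed. *)
Definition sqpos (R : realType) (s : R) : R := Num.max 0 s ^+ 2.

Lemma is_derive_sqpos (R : realType) (s : R) :
  is_derive s (1 : R) (@sqpos R) (2 * Num.max 0 s).
Proof.
have [s0|s0|->] := ltgtP s 0.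
- rewrite mulr0.
  apply: (@near_eq_is_derive _ _ _ (cst 0) (@sqpos R)).
  near=> y; rewrite /sqpos max_l ?expr0n//= ltW//.
  by near: y; exact: lt_nbhsl.
- apply: (@near_eq_is_derive _ _ _ (fun y : R => y ^+ 2) (@sqpos R)).
    near=> y; rewrite /sqpos max_r// ltW//.
    by near: y; exact: lt_nbhsr.
  have H := is_deriveX 2 (is_derive_id s (1 : R)).
  by apply: (is_derive_eq H); rewrite /GRing.scale/= mulr1 expr1.
(* At the kink, max(0, s)^2 = max(0, s) * s with a continuous first factor vanishing at 0. *)
- rewrite ?maxxx mulr0; apply/is_derive1_caratheodory.
  exists (fun z => Num.max 0 z); split => [z||]; last by rewrite maxxx.
    rewrite /sqpos maxxx expr0n/= !subr0 expr2.
    by case: (leP 0 z) => z0; rewrite ?(mul0r, mulr0).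
  by apply: continuous_max; [exact: cst_continuous|exact: cvg_id].
Unshelve. all: by end_near. Qed.

Lemma sqpos_ge0 (R : realType) (s : R) : 0 <= sqpos s.
Proof. exact: sqr_ge0. Qed.

Section decay.
Variable R : realType.
Implicit Types (del s al be : R) (Z : R -> R).

Lemma ge1_powRN_le (x eta eta' : R) : 1 <= x -> eta <= eta' -> x `^ (- eta') <= x `^ (- eta).
Proof. by move=> x1 ee; rewrite ler_powR// lerN2. Qed.

Lemma decaysD del s Z1 Z2 : 0 < s -> decays del s Z1 -> decays del s Z2 ->
  decays del s (fun t => Z1 t + Z2 t).
Proof.
move=> s0 [C1 [e1 [C10 e1s b1]]] [C2 [e2 [C20 e2s b2]]].
exists (C1 + C2), (Num.min e1 e2); split; first exact: addr_ge0.
  by rewrite /Num.min; case: ifP.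
move=> t t0; have t1 : 1 <= 1 + t by rewrite lerDl.
apply: (@le_trans _ _ (expR (del * t) * `|Z1 t| + expR (del * t) * `|Z2 t|)).
  by rewrite -mulrDr ler_wpM2l ?expR_ge0// ler_normD.
rewrite mulrDl; apply: lerD.
  by apply: le_trans (b1 _ t0) _; rewrite ler_wpM2l// ge1_powRN_le// ge_min lexx.
by apply: le_trans (b2 _ t0) _; rewrite ler_wpM2l// ge1_powRN_le// ge_min lexx orbT.
Qed.

Lemma decays_le del s Z1 Z2 K : 0 <= K -> (forall t, 0 <= t -> `|Z2 t| <= K * `|Z1 t|) ->
  decays del s Z1 -> decays del s Z2.
Proof.
move=> K0 Z12 [C [eta [C0 es bnd]]]; exists (K * C), eta; split => //.
  exact: mulr_ge0.
move=> t t0; apply: (@le_trans _ _ (expR (del * t) * (K * `|Z1 t|))).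
  by rewrite ler_wpM2l ?expR_ge0// Z12.
by rewrite mulrCA -mulrA ler_wpM2l// bnd.
Qed.

Lemma exp_le_powRN (eps eta : R) : 0 < eps -> 0 < eta ->
  exists2 C, 0 <= C & forall t, 0 <= t -> expR (- (eps * t)) <= C * (1 + t) `^ (- eta).
Proof.
move=> eps0 eta0; pose k := eps / eta.
have k0 : 0 < k by rewrite divr_gt0.
(* The constant is the one given by ln y <= y - 1 at y = k (1 + t), with k = eps / eta. *)
exists (expR (eta * (k - 1 - ln k))); first exact: expR_ge0.
move=> t t0; have t1 : 0 < 1 + t by rewrite ltr_pwDl.
rewrite powRE// -expRD ler_expR.
have : ln (k * (1 + t)) <= k * (1 + t) - 1.
  have := @le_ln1Dx R (k * (1 + t) - 1); rewrite addrCA subrr addr0; apply.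
  by rewrite ltrBrDl subrr mulr_gt0.
rewrite lnM ?posrE// => H.
have -> : - (eps * t) = eta * (- (k * t)) by rewrite /k; have := lt0r_neq0 eta0 => ?; field.
rewrite mulNr -mulrN -mulrDr ler_pM2l//; lra.
Qed.

(** With a strict exponential gap any power is available, and 2/s is taken as one above 1/s; at the
    critical exponent only the factor (1+t)^(-be) remains and must be summable by itself. *)
Lemma decays_exp_powR del s al be : 0 < s -> 0 <= be ->
  (del < al \/ del = al /\ 1 < be * s) ->
  decays del s (fun t => expR (- (al * t)) * (1 + t) `^ (- be)).
Proof.
move=> s0 be0 [da|[-> bs]]; last first.
  exists 1, be; split => // t t0.
  rewrite ger0_norm ?mulr_ge0 ?expR_ge0 ?powR_ge0// mulrA -expRD subrr expR0.
  by rewrite lexx.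
have ad0 : 0 < al - del by rewrite subr_gt0.
have [C C0 CP] := @exp_le_powRN (al - del) (2 / s) ad0 (divr_gt0 (ltr0Sn _ 1) s0).
exists C, (2 / s); split => //; first by rewrite divfK ?gt_eqF// ltr1n.
move=> t t0; rewrite ger0_norm ?mulr_ge0 ?expR_ge0 ?powR_ge0// mulrA -expRD.
have -> : del * t + - (al * t) = - ((al - del) * t) by ring.
apply: le_trans (CP t t0); rewrite -[leRHS]mulr1 ler_wpM2l ?expR_ge0//.
have t1 : 1 <= 1 + t by rewrite lerDl.
by have := ge1_powRN_le t1 be0; rewrite oppr0 powRr0.
Qed.

End decay.

Section profile.
Variables (R : realType) (k al be : R).
Hypotheses (k0 : 0 < k) (be0 : 0 <= be).

(** Negative for t < 0 and increasing to 1, so that [sqpos (w t)] vanishes on the negative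
    half-line. *)
Let w (t : R) : R := 1 - expR (- k * t).
Let G (t : R) : R := expR (- al * t + - (be / 2) * ln (1 + t ^+ 2)).
Let dG (t : R) : R := G t * (- al - be * t / (1 + t ^+ 2)).

(* 1 + t^2 stands in for (1 + t)^2 to keep the profile smooth on the whole line;
   the parameter k makes the cutoff tend to 1 fast enough for its derivative to be
   negligible against any prescribed exponential weight. *)
Definition profile (t : R) : R := sqpos (w t) * G t.
Definition dprofile (t : R) : R :=
  2 * Num.max 0 (w t) * (k * expR (- k * t)) * G t + sqpos (w t) * dG t.

Let lam0 t : 0 < 1 + t ^+ 2 :> R.
Proof. by rewrite ltr_pwDl// sqr_ge0. Qed.

Let is_derive_lin (c t : R) : is_derive t (1 : R) (fun s => c * s) c.
Proof.
have H := is_deriveZ c (is_derive_id t (1 : R)).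
by apply: (is_derive_eq H); rewrite /GRing.scale/= mulr1.
Qed.

Let is_derive_w t : is_derive t (1 : R) w (k * expR (- k * t)).
Proof.
have H := is_deriveB (is_derive_cst (1 : R) t (1 : R))
  (is_derive1_comp (is_derive_expR (- k * t)) (is_derive_lin (- k) t)).
by apply: (is_derive_eq H); ring.
Qed.

Let is_derive_G t : is_derive t (1 : R) G (dG t).
Proof.
have Hs : is_derive t (1 : R) (fun s : R => 1 + s ^+ 2) (2 * t).
  have H := is_deriveD (is_derive_cst (1 : R) t (1 : R)) (is_deriveX 2 (is_derive_id t (1 : R))).
  by apply: (is_derive_eq H); rewrite add0r /GRing.scale/= mulr1 expr1.
have Hl := @is_derive1_comp R (@ln R) (fun s => 1 + s ^+ 2) t _ _ (is_derive1_ln (lam0 t)) Hs.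
have H1 := is_derive1_comp (is_derive_lin (- (be / 2)) _) Hl.
have H2 := is_deriveD (is_derive_lin (- al) t) H1.
have H := @is_derive1_comp R (@expR R) _ t _ _ (is_derive_expR _) H2.
apply: (is_derive_eq H); rewrite /dG -/(G t).
by have := lt0r_neq0 (lam0 t) => ?; field.
Qed.

Lemma is_derive_profile t : is_derive t (1 : R) profile (dprofile t).
Proof.
have H := is_deriveM (is_derive1_comp (is_derive_sqpos (w t)) (is_derive_w t)) (is_derive_G t).
by apply: (is_derive_eq H); rewrite /dprofile /GRing.scale/=; ring.
Qed.

Lemma dprofile_continuous : continuous dprofile.
Proof.
have cw : continuous w.
  by move=> t; apply/differentiable_continuous/derivable1_diffP; case: (is_derive_w t).
have cG : continuous G.
  by move=> t; apply/differentiable_continuous/derivable1_diffP; case: (is_derive_G t).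
have cm : continuous (fun t => Num.max 0 (w t)).
  by move=> t; apply: continuous_max; [exact: cst_continuous|exact: cw].
have csq : continuous (fun s : R => s ^+ 2).
  by move=> s; exact: exprn_continuous.
move=> t; suff : {for t, continuous (fun t => 2 * Num.max 0 (w t) * (k * expR (- k * t)) * G t +
  sqpos (w t) * dG t)} by [].
apply: continuousD; apply: continuousM.
- apply: continuousM; first by apply: continuousM; [exact: cst_continuous|exact: cm].
  apply: continuousM; first exact: cst_continuous.
  apply: continuous_comp; last exact: continuous_expR.
  exact: mulrl_continuous.
- exact: cG.
- by apply: (continuous_comp (f := fun t => Num.max 0 (w t)) (g := fun s => s ^+ 2));
    [exact: cm|exact: csq].
- rewrite (_ : dG = (fun t => G t * (- al - be * t / (1 + t ^+ 2))))//.
  apply: continuousM; first exact: cG.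
  apply: continuousB; first exact: cst_continuous.
  apply: continuousM; first by apply: mulrl_continuous.
  apply: (@continuousV _ _ (fun t : R => 1 + t ^+ 2)); first exact/lt0r_neq0.
  by apply: continuousD; [exact: cst_continuous|exact: csq].
Qed.

Lemma profile_npos t : t <= 0 -> profile t = 0 /\ dprofile t = 0.
Proof.
move=> t0; have w0 : w t <= 0.
  by rewrite /w subr_le0 -expR0 ler_expR mulNr oppr_ge0 mulr_ge0_le0 // ltW.
rewrite /profile /dprofile /sqpos (max_l w0); split; ring.
Qed.

Let w01 t : 0 <= t -> 0 <= w t <= 1.
Proof.
move=> t0; rewrite /w subr_ge0 gerBl expR_ge0 andbT -expR0 ler_expR.
by rewrite mulNr oppr_le0 mulr_ge0// ltW.
Qed.

Let profile_ge0 t : 0 <= profile t.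
Proof. by rewrite mulr_ge0 ?sqpos_ge0 ?expR_ge0. Qed.

Let GE t : G t = expR (- (al * t)) * (1 + t ^+ 2) `^ (- (be / 2)).
Proof. by rewrite /G expRD mulNr powRE. Qed.

Let powR_sq (x : R) : 0 < x -> (x ^+ 2) `^ (- (be / 2)) = x `^ (- be).
Proof.
move=> x0; rewrite -powR_mulrn ?(ltW x0)// -powRrM; congr (_ `^ _).
by rewrite mulrN mulrC divfK.
Qed.

(** The factor 2^(be/2) comes from (1 + t)^2 <= 2 (1 + t^2). *)
Let G_le t : 0 <= t -> G t <= 2 `^ (be / 2) * (expR (- (al * t)) * (1 + t) `^ (- be)).
Proof.
move=> t0; rewrite GE mulrCA ler_wpM2l ?expR_ge0//.
have t1 : 0 < 1 + t by rewrite ltr_pwDl.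
apply: (@le_trans _ _ (((1 + t) ^+ 2 / 2) `^ (- (be / 2)))).
  apply: ge0_powRN_le; rewrite ?divr_ge0// ?divr_gt0 ?exprn_gt0//.
  by rewrite ler_pdivrMr//; have := sqr_ge0 (1 - t); nra.
rewrite powRM ?invr_ge0 ?exprn_ge0 ?(ltW t1)// powR_sq// mulrC ler_wpM2r ?powR_ge0//.
by rewrite -powR_inv1// -powRrM mulN1r opprK.
Qed.

Let G_ge t : 0 <= t -> expR (- (al * t)) * (1 + t) `^ (- be) <= G t.
Proof.
move=> t0; rewrite GE ler_wpM2l ?expR_ge0//.
have t1 : 0 < 1 + t by rewrite ltr_pwDl.
rewrite -powR_sq//; apply: ge0_powRN_le; rewrite ?divr_ge0//.
nra.
Qed.

Lemma profile_decays del s : 0 < s -> (del < al \/ del = al /\ 1 < be * s) ->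
  decays del s profile.
Proof.
move=> s0 h; apply: (@decays_le _ _ _ _ _ (2 `^ (be / 2)) _ _ (decays_exp_powR s0 be0 h));
  first exact: (powR_ge0 2 (be / 2)).
move=> t t0; have /andP[w0 w1] := w01 t0.
rewrite (ger0_norm (profile_ge0 t)).
rewrite ger0_norm ?mulr_ge0 ?powR_ge0 ?expR_ge0//.
apply: le_trans (G_le t0); rewrite /profile -[leRHS]mul1r ler_wpM2r ?expR_ge0//.
by rewrite /sqpos (max_r w0) exprn_ile1.
Qed.

(** The derivative has three terms. That of the cut-off gains e^(-k t); that of the exponential
    carries the factor [al] and gains nothing; that of the power carries the factor [be] and gains
    1/(1+t). Hence the alternatives [al = 0] and [be = 0], and the exponent [be + 1]. *)
Lemma dprofile_decays del s : 0 < s -> del < al + k ->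
  (al = 0 \/ del < al \/ del = al /\ 1 < be * s) ->
  (be = 0 \/ del < al \/ del = al /\ 1 < (be + 1) * s) ->
  decays del s dprofile.
Proof.
move=> s0 hk ha hb.
pose Z1 t := 2 * Num.max 0 (w t) * (k * expR (- k * t)) * G t.
pose Z2 t := - al * (sqpos (w t) * G t).
pose Z3 t := - be * (t / (1 + t ^+ 2)) * (sqpos (w t) * G t).
have -> : dprofile = fun t => Z1 t + (Z2 t + Z3 t).
  by apply/funext => t; rewrite /dprofile /Z1 /Z2 /Z3 /dG; ring.
have sG0 t : 0 <= sqpos (w t) * G t by rewrite mulr_ge0 ?sqpos_ge0 ?expR_ge0.
have sG t : 0 <= t -> sqpos (w t) * G t <= G t.
  move=> t0; have /andP[w0 w1] := w01 t0.
  by rewrite -[leRHS]mul1r ler_wpM2r ?expR_ge0// /sqpos (max_r w0) exprn_ile1.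
pose M := 2 `^ (be / 2) : R.
have M0 : 0 <= M by exact: powR_ge0.
apply: decaysD => //; last apply: decaysD => //.
- have h1 : del < al + k \/ del = al + k /\ 1 < be * s by left.
  apply: (@decays_le _ _ _ _ _ (2 * k * M) _ _ (decays_exp_powR s0 be0 h1));
    first exact: (mulr_ge0 (mulr_ge0 (ler0n R 2) (ltW k0)) M0).
  move=> t t0; have /andP[w0 w1] := w01 t0.
  rewrite [X in _ <= _ * X]ger0_norm ?mulr_ge0 ?powR_ge0 ?expR_ge0//.
  rewrite /Z1 (max_r w0) ger0_norm ?mulr_ge0 ?expR_ge0 ?(ltW k0)//.
  have -> : 2 * k * M * (expR (- ((al + k) * t)) * (1 + t) `^ (- be)) =
      2 * (k * expR (- k * t)) * (M * (expR (- (al * t)) * (1 + t) `^ (- be))).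
    have -> : - ((al + k) * t) = - (al * t) + - k * t by ring.
    by rewrite expRD; ring.
  apply: ler_pM; rewrite ?mulr_ge0 ?expR_ge0 ?(ltW k0)//; last exact: G_le.
  rewrite -mulrA ler_wpM2l// -[leRHS]mul1r ler_wpM2r// mulr_ge0 ?expR_ge0//.
  exact: ltW.
- case: ha => [a0|ha].
    exists 0, (2 / s); split; rewrite ?divfK ?gt_eqF ?ltr1n// => t _.
    by rewrite /Z2 a0 oppr0 mul0r normr0 mulr0 mul0r.
  apply: (@decays_le _ _ _ _ _ (`|al| * M) _ _ (decays_exp_powR s0 be0 ha));
    first exact: (mulr_ge0 (normr_ge0 al) M0).
  move=> t t0; rewrite [X in _ <= _ * X]ger0_norm ?mulr_ge0 ?powR_ge0 ?expR_ge0//.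
  rewrite /Z2 normrM normrN -[leRHS]mulrA (ger0_norm (sG0 t)).
  apply: ler_wpM2l => //.
  exact: le_trans (sG t t0) (G_le t0).
- case: hb => [b0|hb].
    exists 0, (2 / s); split; rewrite ?divfK ?gt_eqF ?ltr1n// => t _.
    by rewrite /Z3 b0 oppr0 !mul0r normr0 mulr0.
  have be1 : 0 <= be + 1 by rewrite addr_ge0.
  apply: (@decays_le _ _ _ _ _ (2 * be * M) _ _ (decays_exp_powR s0 be1 hb));
    first exact: (mulr_ge0 (mulr_ge0 (ler0n R 2) be0) M0).
  move=> t t0; rewrite [X in _ <= _ * X]ger0_norm ?mulr_ge0 ?powR_ge0 ?expR_ge0//.
  have t1 : 0 < 1 + t by rewrite ltr_pwDl.
  have -> : (1 + t) `^ (- (be + 1)) = (1 + t) `^ (- be) * (1 + t)^-1.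
    by rewrite -powR_inv1 ?(ltW t1)// -powRD ?(gt_eqF t1) ?implybT// opprD.
  have tl0 : 0 <= t / (1 + t ^+ 2) by rewrite divr_ge0// ltW.
  have Z3E : `|Z3 t| = be * (t / (1 + t ^+ 2)) * (sqpos (w t) * G t).
    by rewrite /Z3 mulNr mulNr normrN ger0_norm// mulr_ge0// mulr_ge0.
  rewrite Z3E.
  have tl : t / (1 + t ^+ 2) <= 2 * (1 + t)^-1.
    by rewrite ler_pdivrMr// mulrAC ler_pdivlMr//; have := sqr_ge0 (1 - t); nra.
  have -> : 2 * be * M * (expR (- (al * t)) * ((1 + t) `^ (- be) / (1 + t))) =
      be * (2 * (1 + t)^-1) * (M * (expR (- (al * t)) * (1 + t) `^ (- be))) by ring.
  apply: ler_pM => //; first exact: mulr_ge0.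
    by rewrite ler_wpM2l.
  exact: le_trans (sG t t0) (G_le t0).
Qed.

(** For t >= 1 the increasing cut-off is at least its value at 1. The r-th power of the lower bound
    is a multiple of 1/(1+t), exactly what divergence requires. *)
Lemma profile_ge r gam : 0 < r -> al <= gam -> be * r <= 1 ->
  forall t, 1 <= t -> (w 1) ^+ 2 * (1 + t) `^ (- r^-1) <= expR (gam * t) * `|profile t|.
Proof.
move=> r0 ag br t t1; have t0 : 0 <= t by lra.
have /andP[w0 w1] := w01 t0.
rewrite (ger0_norm (profile_ge0 t)).
have h1 : w 1 ^+ 2 <= sqpos (w t).
  rewrite /sqpos (max_r w0) lerXn2r ?nnegrE//.
    by have /andP[] := w01 (@ler01 R).
  by rewrite /w lerD2l lerN2 ler_expR mulr1 !mulNr lerN2 ler_peMr// ltW.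
rewrite mulrCA; apply: ler_pM; rewrite ?sqr_ge0 ?powR_ge0//.
apply: (@le_trans _ _ (expR (gam * t) * (expR (- (al * t)) * (1 + t) `^ (- be)))).
  rewrite mulrA -expRD -[leLHS]mul1r; apply: ler_pM => //; rewrite ?powR_ge0//.
    by rewrite -expR0 ler_expR -mulrBl mulr_ge0// subr_ge0.
  by apply: ge1_powRN_le; [lra|rewrite -[r^-1]mul1r ler_pdivlMr].
by rewrite ler_wpM2l ?expR_ge0// G_ge.
Qed.

Lemma profile_w1_gt0 : 0 < (w 1) ^+ 2.
Proof. by rewrite exprn_gt0// /w subr_gt0 mulr1 expR_lt1 oppr_lt0. Qed.

End profile.

(** * Bumps *)

Section bump.
Variables (R : realType) (n : nat) (x0 : 'rV[R]_n.+1) (del : R).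
Hypothesis del0 : 0 < del.

Let arg (x : 'rV[R]_n.+1) : R := 1 - sqnorm (x - x0) / del ^+ 2.

(** The squared distance inside [arg] keeps the bump C^1 at its centre. *)
Definition bump (x : 'rV[R]_n.+1) : R := sqpos (arg x).
Definition bump_grad (x : 'rV[R]_n.+1) : 'rV[R]_n.+1 :=
  (- 4 * Num.max 0 (arg x) / del ^+ 2) *: (x - x0).

Let arg_continuous : continuous arg.
Proof.
move=> x; suff : {for x, continuous (fun x : 'rV[R]_n.+1 => 1 - sqnorm (x - x0) / del ^+ 2)} by [].
apply: continuousB; first exact: cst_continuous.
apply: continuousM; last exact: cst_continuous.
apply: (continuous_comp (f := fun y : 'rV[R]_n.+1 => y - x0) (g := @sqnorm R n.+1)).
  by apply: continuousB; [exact: cvg_id|exact: cst_continuous].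
exact: sqnorm_continuous.
Qed.

Let is_derive_arg x i :
  is_derive x (delta_mx 0 i : 'rV[R]_n.+1) arg (- (2 * (x - x0) ord0 i) / del ^+ 2).
Proof.
have D0 : del ^+ 2 != 0 by rewrite gt_eqF// exprn_gt0.
have ds : is_derive x (delta_mx 0 i : 'rV[R]_n.+1) (fun y : 'rV[R]_n.+1 => sqnorm (y - x0))
    (2 * (x - x0) ord0 i).
  rewrite -[x in is_derive x](add0r x) -(scale0r (delta_mx 0 i)).
  apply: (is_derive_line _ _ _ _ _).2.
  rewrite (_ : (fun s : R => _) = (fun s : R => sqnorm (s *: delta_mx 0 i + (x - x0)))).
    apply: (is_derive_line _ _ _ _ _).1; rewrite scale0r add0r.
    exact: is_derive_sqnorm.
  by apply/funext => s; rewrite addrA.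
have H := is_deriveB (is_derive_cst (1 : R) x (delta_mx 0 i : 'rV[R]_n.+1))
  (is_deriveM ds (is_derive_cst ((del ^+ 2)^-1 : R) x (delta_mx 0 i : 'rV[R]_n.+1))).
apply: (is_derive_eq H); rewrite /GRing.scale/=.
by field; exact: lt0r_neq0.
Qed.

Lemma bump_c1 : c1_off0 bump bump_grad.
Proof.
move=> x _.
have csq : continuous (@sqpos R).
  by move=> t; apply/differentiable_continuous/derivable1_diffP; case: (is_derive_sqpos t).
split.
- by apply: continuous_comp; [exact: arg_continuous|exact: csq].
- move=> i; rewrite (_ : (fun y => _) =
    (fun y : 'rV[R]_n.+1 => - 4 * Num.max 0 (arg y) / del ^+ 2 * (y ord0 i - x0 ord0 i)));
    last by apply/funext => y; rewrite !mxE.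
  apply: continuousM.
    apply: continuousM; last exact: cst_continuous.
    apply: continuousM; first exact: cst_continuous.
    by apply: continuous_max; [exact: cst_continuous|exact: arg_continuous].
  by apply: continuousB; [exact: continuous_coord|exact: cst_continuous].
- move=> i; have H := is_derive_chain (is_derive_arg x i) (is_derive_sqpos (arg x)).
  by apply: (is_derive_eq H); rewrite /bump_grad !mxE; ring.
Qed.

Let arg_le1 x : arg x <= 1.
Proof. by rewrite /arg gerBl divr_ge0 ?sqnorm_ge0// exprn_ge0// ltW. Qed.

Lemma bump_le1 x : `|bump x| <= 1.
Proof.
rewrite ger0_norm ?sqpos_ge0// /bump /sqpos exprn_ile1// ?le_max ?lexx//.
by rewrite ge_max ler01 arg_le1.
Qed.

Lemma bump_supp x : del <= enorm (x - x0) -> bump x = 0 /\ bump_grad x = 0.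
Proof.
move=> dx; have a0 : arg x <= 0.
  rewrite /arg subr_le0 ler_pdivlMr ?exprn_gt0// mul1r -enorm_sq.
  by rewrite lerXn2r// nnegrE ?enorm_ge0// ltW.
by rewrite /bump /bump_grad /sqpos max_l// mulr0 mul0r scale0r expr0n.
Qed.

Lemma bump_ge x : enorm (x - x0) <= del / 2 -> 2^-1 <= `|bump x|.
Proof.
move=> xd; have a1 : 3 / 4 <= arg x.
  have : sqnorm (x - x0) / del ^+ 2 <= 1 / 4.
    rewrite ler_pdivrMr ?exprn_gt0// -enorm_sq.
    have -> : 1 / 4 * del ^+ 2 = (del / 2) ^+ 2 by field.
    by rewrite lerXn2r// nnegrE ?enorm_ge0// divr_ge0// ltW.
  rewrite /arg; lra.
rewrite ger0_norm ?sqpos_ge0// /bump /sqpos max_r; last by apply: le_trans a1; lra.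
by nra.
Qed.

Lemma bump_grad_le x : enorm (bump_grad x) <= 4 / del.
Proof.
have d4 : 0 <= 4 / del by rewrite divr_ge0// ltW.
have [/bump_supp[_ ->]|xd] := leP del (enorm (x - x0)); first by rewrite enorm0.
have m0 : 0 <= Num.max 0 (arg x) by rewrite le_max lexx.
have m1 : Num.max 0 (arg x) <= 1 by rewrite ge_max ler01 arg_le1.
rewrite enormZ !normrM normrN normfV (ger0_norm m0) (ger0_norm (ler0n R 4)).
rewrite (ger0_norm (exprn_ge0 2 (ltW del0))).
have -> : 4 / del = 4 * 1 / del ^+ 2 * del by have := lt0r_neq0 del0 => ?; field.
apply: ler_pM; rewrite ?enorm_ge0 ?divr_ge0 ?mulr_ge0 ?exprn_ge0 ?(ltW xd) ?(ltW del0)//.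
by rewrite ler_pM2r ?invr_gt0 ?exprn_gt0// ler_pM2l.
Qed.

End bump.

(** * Norms of a bump in logarithmic parameters *)

Section bump_norms.
Variables (R : realType) (n : nat) (lam tau : R).
Hypothesis tau2 : ln 2 <= tau.

(** Here eps = e^(-tau). In the parameters [lam] and [tau] every estimate is the exponential of an
    affine function, so the final choice of scales becomes linear. The assumption on [tau] gives del
    <= rho / 2, which keeps the bump away from the origin. *)
Let rho : R := expR lam.
Let del : R := expR (lam - tau).
Let N : R := n.+1%:R.
Let B : R := 2 * N.
(** Equal coordinates make the cubes around the centre powers of a single interval, the form covered
    by [cube]. *)
Let x0 : 'rV[R]_n.+1 := const_mx rho.

Let N1 : 1 <= N. Proof. by rewrite /N ler1n. Qed.
Let rho0 : 0 < rho. Proof. exact: expR_gt0. Qed.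
Let del0 : 0 < del. Proof. exact: expR_gt0. Qed.
Let B1 : 1 <= B. Proof. by have := N1; rewrite /B; lra. Qed.

Let del_rho : del <= rho / 2.
Proof.
rewrite /del /rho expRD ler_pM2l ?expR_gt0// expRN lef_pV2 ?posrE ?expR_gt0//.
by rewrite -[leLHS]lnK ?posrE// ler_expR.
Qed.

Lemma enorm_le_coord (x : 'rV[R]_n.+1) m : 0 <= m -> (forall i, `|x ord0 i| <= m) ->
  enorm x <= n.+1%:R * m.
Proof.
move=> m0 xm; rewrite -[leRHS]ger0_norm ?mulr_ge0// -sqrtr_sqr ler_wsqrtr//.
apply: (@le_trans _ _ (\sum_(i < n.+1) m ^+ 2)).
  apply: ler_sum => i _; rewrite -[x ord0 i ^+ 2]ger0_norm ?sqr_ge0// normrX.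
  by rewrite lerXn2r// nnegrE.
rewrite sumr_const card_ord -[leLHS]mulr_natl exprMn ler_wpM2r ?sqr_ge0//.
by rewrite expr2 ler_peMl.
Qed.

(** On the bump, ln |x| stays within ln B of [lam]; using |d| treats both signs of the exponent at
    once. *)
Let weight_bounds (d : R) (x : 'rV[R]_n.+1) :
  (forall i, rho / 2 <= x ord0 i <= 3 / 2 * rho) ->
  expR (d * lam - `|d| * ln B) <= enorm x `^ d <= expR (d * lam + `|d| * ln B).
Proof.
move=> xr; have i0 : 'I_n.+1 := ord0.
have lo : rho / 2 <= enorm x.
  have /andP[h _] := xr i0; apply: le_trans h (le_trans (ler_norm _) _).
  exact: coord_le_enorm.
have up : enorm x <= N * (3 / 2 * rho).
  apply: enorm_le_coord => [|i]; first by rewrite !mulr_ge0 ?(ltW rho0).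
  have /andP[h1 h2] := xr i; rewrite ger0_norm//.
  by apply: le_trans h1; rewrite divr_ge0// ltW.
have e0 : 0 < enorm x by apply: lt_le_trans lo; rewrite divr_gt0.
have B0 : 0 < B by apply: lt_le_trans B1.
have l1 : ln (enorm x) <= ln B + lam.
  rewrite -[lam]expRK -lnM ?posrE//; rewrite ler_ln ?posrE ?mulr_gt0//.
  by apply: le_trans up _; rewrite /B mulrA ler_wpM2r ?(ltW rho0)//; have := N1; lra.
have l2 : lam - ln B <= ln (enorm x).
  rewrite -[lam]expRK -ln_div ?posrE//; rewrite ler_ln ?posrE ?divr_gt0//.
  apply: le_trans lo; rewrite ler_wpM2l ?(ltW rho0)// lef_pV2 ?posrE// /B.
  by have := N1; lra.
have H : `|d * (ln (enorm x) - lam)| <= `|d| * ln B.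
  by rewrite normrM ler_wpM2l// ler_norml; apply/andP; split; lra.
rewrite powRE// !ler_expR; move: H; rewrite ler_norml mulrBr => /andP[h1 h2].
by apply/andP; split; lra.
Qed.

Let cube_x0 (y : mT (lebS R n)) (h : R) : h <= rho / 2 -> cube (rho - h) (rho + h) y ->
  (forall i, rho / 2 <= (@toRV R n.+1 y) ord0 i <= 3 / 2 * rho) /\
  (forall i, `|(@toRV R n.+1 y - x0) ord0 i| < h).
Proof.
move=> hr cy; split=> i; have /andP[c1 c2] := cy i.
  by rewrite toRVE; apply/andP; split; lra.
by rewrite !mxE inord_val ltr_norml; apply/andP; split; lra.
Qed.

(** The exponent collects the weight, the s-th power of the sup bound e^nu, and the volume (2 del)^N
    of a cube containing the support. *)
Lemma wint_bump_le d s (v : 'rV[R]_n.+1 -> R) nu : 0 < s -> meas v ->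
  (forall x, `|v x| <= expR nu) -> (forall x, del <= enorm (x - x0) -> v x = 0) ->
  (wint d s v <= (expR (d * lam + `|d| * ln B + s * nu + (ln 2 + lam - tau) * N))%:E)%E.
Proof.
move=> s0 mv vnu vsupp; pose Q := @cube R n (rho - del) (rho + del).
pose e : R := expR (d * lam + `|d| * ln B) * expR (s * nu).
have mQ : measurable Q := @measurable_cube R n _ _.
have e0 : 0 <= e by rewrite mulr_ge0 ?expR_ge0.
apply: (@le_trans _ _ (\int[mmu (lebS R n)]_y (e%:E * (\1_Q y)%:E))%E).
  apply: ge0_le_integral => //.
  - by move=> y _; rewrite lee_fin mulr_ge0 ?powR_ge0.
  - by apply/measurable_EFinP; exact: meas_weighted.
  - by apply/measurable_EFinP; apply: measurable_funM.
  - move=> y _; rewrite -EFinM lee_fin indicE.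
    have [/set_mem yQ|yQ] := boolP (y \in Q).
      have [xr _] := cube_x0 del_rho yQ; rewrite mulr1.
      apply: ler_pM; rewrite ?powR_ge0//; first by have /andP[] := weight_bounds d xr.
      rewrite mulrC expRM; rewrite ge0_ler_powR ?(ltW s0)// ?nnegrE ?expR_ge0//.
    rewrite vsupp; first by rewrite normr0 powR0 ?gt_eqF// !mulr0.
    rewrite leNgt; apply: contra yQ => yd; rewrite inE => i.
    have := le_lt_trans (coord_le_enorm _ i) yd.
    rewrite !mxE inord_val ltr_norml => /andP[h1 h2].
    by apply/andP; split; lra.
rewrite ge0_integralZl//; last by apply/measurable_EFinP.
rewrite integral_indic// setIT [X in (_ * X)%E]measure_cube; last by have := del0; lra.
have -> : rho + del - (rho - del) = expR (ln 2 + lam - tau).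
  by rewrite -(addrA (ln 2)) expRD lnK ?posrE// -/del; ring.
by rewrite -EFinM lee_fin /e -expRM_natr -!expRD.
Qed.

Lemma wint_bump_ge d s (v : 'rV[R]_n.+1 -> R) nu : 0 < s -> meas v ->
  (forall x, enorm (x - x0) <= del / 2 -> expR nu <= `|v x|) ->
  ((expR (d * lam - `|d| * ln B + s * nu + (lam - tau - ln N) * N))%:E <= wint d s v)%E.
Proof.
move=> s0 mv vnu; have N0 : 0 < N by apply: lt_le_trans N1.
(* The Euclidean norm is at most N times the largest coordinate, so this cube lies in the ball of
   radius N h = del / 2, where [v] is bounded below. *)
pose h := del / (2 * N); have h0 : 0 < h by rewrite divr_gt0// mulr_gt0.
pose Q := @cube R n (rho - h) (rho + h).
pose e : R := expR (d * lam - `|d| * ln B) * expR (s * nu).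
have mQ : measurable Q := @measurable_cube R n _ _.
have e0 : 0 <= e by rewrite mulr_ge0 ?expR_ge0.
have Nh : N * h = del / 2 by rewrite /h; have := lt0r_neq0 N0 => ?; field.
have hr : h <= rho / 2.
  apply: le_trans del_rho; rewrite /h ler_pdivrMr ?mulr_gt0// -[leLHS]mulr1.
  by apply: ler_wpM2l; [exact: ltW|exact: B1].
apply: (@le_trans _ _ (\int[mmu (lebS R n)]_y (e%:E * (\1_Q y)%:E))%E); last first.
  apply: ge0_le_integral => //.
  - by move=> y _; rewrite -EFinM lee_fin mulr_ge0.
  - by apply/measurable_EFinP; apply: measurable_funM.
  - by apply/measurable_EFinP; exact: meas_weighted.
  - move=> y _; rewrite -EFinM lee_fin indicE.
    have [/set_mem yQ|yQ] := boolP (y \in Q); last by rewrite mulr0 mulr_ge0 ?powR_ge0.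
    have [xr xh] := cube_x0 hr yQ; rewrite mulr1.
    apply: ler_pM; rewrite ?expR_ge0//; first by have /andP[] := weight_bounds d xr.
    rewrite mulrC expRM; rewrite ge0_ler_powR ?(ltW s0)// ?nnegrE ?expR_ge0//.
    apply: vnu; rewrite -Nh; apply: enorm_le_coord => [|i]; first exact: ltW.
    exact/ltW/xh.
rewrite ge0_integralZl//; last by apply/measurable_EFinP.
rewrite integral_indic// setIT [X in (_ * X)%E]measure_cube; last lra.
have -> : rho + h - (rho - h) = expR (lam - tau - ln N).
  rewrite expRD expRN lnK ?posrE// -/del /h.
  by have := lt0r_neq0 N0 => ?; field.
by rewrite -EFinM lee_fin /e -expRM_natr -!expRD.
Qed.

Lemma wnorm_le_exp d s (v : 'rV[R]_n.+1 -> R) e : 0 < s ->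
  (wint d s v <= (expR e)%:E)%E -> wnorm d s v <= expR (e / s).
Proof.
move=> s0 H; rewrite expRM ge0_ler_powR ?invr_ge0 ?(ltW s0)// ?nnegrE ?expR_ge0//.
  by apply: fine_ge0; exact: wint_ge0.
have fin : wint d s v \is a fin_num.
  by rewrite (ge0_fin_numE (wint_ge0 _ _ _)); exact: le_lt_trans H (ltry _).
by move: H; rewrite -(fineK fin) lee_fin.
Qed.

(** Finiteness matters here: [fine] sends +oo to 0, so a divergent integral would have [wnorm] equal
    to 0. *)
Lemma wnorm_ge_exp d s (v : 'rV[R]_n.+1 -> R) e : 0 < s -> (wint d s v < +oo)%E ->
  ((expR e)%:E <= wint d s v)%E -> expR (e / s) <= wnorm d s v.
Proof.
move=> s0 vfin H; rewrite expRM ge0_ler_powR ?invr_ge0 ?(ltW s0)// ?nnegrE ?expR_ge0//.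
  by apply: fine_ge0; exact: wint_ge0.
have fin : wint d s v \is a fin_num by rewrite (ge0_fin_numE (wint_ge0 _ _ _)).
by move: H; rewrite -(fineK fin) lee_fin.
Qed.

(** The values of nu are 0 for |bump| <= 1, ln (4 / del) for the gradient, and - ln 2 for the lower
    bound on the ball of half radius. *)
Lemma bump_emb_bound a b c p q r C : 0 < p -> 0 < q -> 0 < r -> 0 <= C ->
  @c1_emb_L R n a b q p c r C ->
  expR ((c * lam - `|c| * ln B + r * - ln 2 + (lam - tau - ln N) * N) / r) <=
  C * (expR ((a * lam + `|a| * ln B + q * 0 + (ln 2 + lam - tau) * N) / q) +
    expR ((b * lam + `|b| * ln B + p * (ln 4 - lam + tau) + (ln 2 + lam - tau) * N) / p)).
Proof.
move=> p0 q0 r0 C0 emb.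
have ug := bump_c1 x0 del0.
have mu : meas (bump x0 del) by apply: meas_continuous_off0 => x /ug[].
have mg : meas (fun x => enorm (bump_grad x0 del x)).
  apply: meas_continuous_off0 => x xn0; apply: continuous_comp; last exact: enorm_continuous.
  by apply: continuous_mx => i; have [_ + _] := ug x xn0; apply.
have uq : (wint a q (bump x0 del) <=
    (expR (a * lam + `|a| * ln B + q * 0 + (ln 2 + lam - tau) * N))%:E)%E.
  apply: wint_bump_le => // x; first by rewrite expR0 bump_le1.
  by move=> /(bump_supp del0)[].
have gp : (wint b p (fun x => enorm (bump_grad x0 del x)) <=
    (expR (b * lam + `|b| * ln B + p * (ln 4 - lam + tau) + (ln 2 + lam - tau) * N))%:E)%E.
  apply: wint_bump_le => // x.
    rewrite ger0_norm ?enorm_ge0//; apply: le_trans (bump_grad_le _ del0 _) _.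
    by rewrite -(addrA (ln 4)) expRD lnK ?posrE// /del -expRN opprB addrC.
  by move=> /(bump_supp del0)[_ ->]; rewrite enorm0.
have [ur le] := emb _ _ ug (le_lt_trans uq (ltry _)) (le_lt_trans gp (ltry _)).
have low : ((expR (c * lam - `|c| * ln B + r * - ln 2 + (lam - tau - ln N) * N))%:E <=
    wint c r (bump x0 del))%E.
  apply: wint_bump_ge => // x xd; rewrite expRN lnK ?posrE//.
  exact: bump_ge.
apply: le_trans (wnorm_ge_exp r0 ur low) (le_trans le _).
by apply: ler_wpM2l => //; apply: lerD; exact: wnorm_le_exp.
Qed.

End bump_norms.

(** * Non-embedding *)

Lemma bump_not_emb (R : realType) n (a b c p q r C : R) : 0 < p -> 0 < q -> q < r ->
  (a + n.+1%:R) / q != (b - p + n.+1%:R) / p -> (c + n.+1%:R) / r = (a + n.+1%:R) / q ->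
  0 <= C -> ~ @c1_emb_L R n a b q p c r C.
Proof.
move=> p0 q0 qr al01 gam C0 emb; have r0 := lt_trans q0 qr.
set N : R := n.+1%:R in al01 gam.
have N0 : 0 < N by rewrite ltr0n.
set al0 := (a + N) / q in al01 gam; set al1 := (b - p + N) / p in al01.
(* [C] may be 0, so 1 + C is used to bound it by an exponential. *)
pose D := ln (1 + C).
have CD : C <= expR D by rewrite lnK ?posrE ?ltr_pwDl// lerDr.
pose Bl : R := ln (2 * N).
pose k0 := (- `|c| * Bl - r * ln 2 - ln N * N) / r.
pose k1 := (`|a| * Bl + ln 2 * N) / q.
pose k2 := (`|b| * Bl + p * ln 4 + ln 2 * N) / p.
have qr0 : 0 < N / q - N / r by rewrite subr_gt0 ltr_pM2l// ltf_pV2.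
(* This makes the L^q term, including C, at most e^(-1) times the left side. Because gam = al0, the
   comparison does not involve [lam], which is still free. *)
pose tau := Num.max (ln 2) ((k1 + D - k0 + 1) / (N / q - N / r)).
have tau1 : ln 2 <= tau by rewrite le_max lexx.
have tau2 : k1 + D - k0 + 1 <= tau * (N / q - N / r).
  by rewrite -ler_pdivrMr// le_max lexx orbT.
(* The solution of D + E2 = E0 - 1, solvable since al0 and al1 differ; its sign decides whether the
   bump goes to the origin or to infinity. *)
pose lam := (k0 - N / r * tau - 1 - D - k2 + (N / p - 1) * tau) / (al1 - al0).
have lamE : lam * (al1 - al0) = k0 - N / r * tau - 1 - D - k2 + (N / p - 1) * tau.
  by rewrite divfK// subr_eq0 eq_sym.
have := @bump_emb_bound R n lam tau tau1 a b c p q r C p0 q0 r0 C0 emb.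
rewrite -/N -/Bl.
have -> : (c * lam - `|c| * Bl + r * - ln 2 + (lam - tau - ln N) * N) / r =
    (c + N) / r * lam - N / r * tau + k0.
  by rewrite /k0; have := lt0r_neq0 r0 => ?; field.
have -> : (a * lam + `|a| * Bl + q * 0 + (ln 2 + lam - tau) * N) / q =
    al0 * lam - N / q * tau + k1.
  by rewrite /k1 /al0; have := lt0r_neq0 q0 => ?; field.
have -> : (b * lam + `|b| * Bl + p * (ln 4 - lam + tau) + (ln 2 + lam - tau) * N) / p =
    al1 * lam - (N / p - 1) * tau + k2.
  by rewrite /k2 /al1; have := lt0r_neq0 p0 => ?; field.
rewrite gam; set E0 := _ + k0; set E1 := _ + k1; set E2 := _ + k2 => H.
have h1 : D + E1 <= E0 - 1 by rewrite /E1 /E0; lra.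
have h2 : D + E2 <= E0 - 1 by rewrite /E2 /E0; lra.
have : C * (expR E1 + expR E2) <= expR (E0 - 1) + expR (E0 - 1).
  apply: (@le_trans _ _ (expR D * (expR E1 + expR E2))).
    by rewrite ler_wpM2r// addr_ge0 ?expR_ge0.
  by rewrite mulrDr -!expRD lerD// ler_expR.
move=> /(le_trans H); rewrite -[in leLHS](subrK 1 E0) expRD.
(* The two terms on the right add up to at most 2 e^(E0 - 1), which is below e^E0. *)
have e2 : 2 < expR 1 :> R by apply: le_lt_trans (expR_gt1Dx (oner_neq0 R)); lra.
have := expR_gt0 (E0 - 1); nra.
Qed.

(** Reduces non-inclusion to comparing exponents: the first condition gives the L^q norm, the next
    two control the terms of the derivative that survive the cut-off, and the last two force
    divergence in L^r. *)
Lemma profile_not_sub (R : realType) n (sgm a b c p q r al be : R) :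
  (sgm = 1 \/ sgm = -1) -> 0 < p -> 0 < q -> 0 < r -> 0 <= be ->
  let A0 := sgm * ((a + n.+1%:R) / q) in
  let A1 := sgm * ((b - p + n.+1%:R) / p) in
  (A0 < al \/ A0 = al /\ 1 < be * q) ->
  (al = 0 \/ A1 < al \/ A1 = al /\ 1 < be * p) ->
  (be = 0 \/ A1 < al \/ A1 = al /\ 1 < (be + 1) * p) ->
  al <= sgm * ((c + n.+1%:R) / r) -> be * r <= 1 ->
  ~ W_sub_L n.+1 a b q p c r /\ ~ Wt_sub_L n.+1 a b q p c r.
Proof.
move=> sgm1 p0 q0 r0 be0 A0 A1 h0 h1 h2 alG ber.
(* Large enough for the derivative of the cut-off to beat the gradient weight. *)
pose k := `|A1 - al| + 1.
have k0 : 0 < k by rewrite ltr_pwDr.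
have kA : A1 < al + k by rewrite /k; have := ler_norm (A1 - al); lra.
apply: (@radial_not_sub _ n sgm sgm1 (profile k al be) (dprofile k al be) a b c p q r
  A0 A1 (sgm * ((c + n.+1%:R) / r)) ((1 - expR (- k * 1)) ^+ 2)) => //.
- by rewrite -mulrA divfK// gt_eqF.
- by rewrite -mulrA divfK// gt_eqF.
- by rewrite -mulrA divfK// gt_eqF.
- by move=> t; exact: is_derive_profile.
- exact: dprofile_continuous.
- by move=> t t0; exact: profile_npos.
- exact: profile_decays.
- exact: dprofile_decays.
- exact: profile_w1_gt0.
- by move=> t t1; exact: profile_ge.
Qed.

Theorem theorem2p1 (R : realType) (N : nat) (a b c p q r : R) :
  (1 <= N)%N -> 1 <= p -> 0 < q -> 0 < r ->
  ( (* (i) or (ii)  ==>  W, W~ not contained in L^r(|x|^c dx) *)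
    ( (c < Num.min (c0 N a q r) (c1 N b p r) \/ Num.max (c0 N a q r) (c1 N b p r) < c)
      \/ ( ((b - p <= - N%:R /\ - N%:R < a) \/ (- N%:R <= b - p /\ a < - N%:R))
           /\ ~ ((c0 N a q r <= c /\ c < - N%:R) \/ (- N%:R < c /\ c <= c0 N a q r)) ) )
    -> ~ W_sub_L N a b q p c r /\ ~ Wt_sub_L N a b q p c r )
  /\
  ( (* (iii)-(vi)  ==>  W, W~ not continuously embedded into L^r(|x|^c dx) *)
    ( [/\ (a + N%:R) / q != (b - p + N%:R) / p, c = c0 N a q r & r != q]
      \/ [/\ (a + N%:R) / q != (b - p + N%:R) / p, c = c1 N b p r & r < p]
      \/ [/\ (a + N%:R) / q = (b - p + N%:R) / p, r < Num.min p q & c = c0 N a q r]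
      \/ [/\ a = - N%:R, b = p - N%:R, r < q & c = c0 N a q r] )
    -> ~ W_emb_L N a b q p c r /\ ~ Wt_emb_L N a b q p c r ).
Proof.
case: N => [//|n] _ p1 q0 r0; have p0 : 0 < p by lra.
set al0 := (a + n.+1%:R) / q; set al1 := (b - p + n.+1%:R) / p.
pose gam := (c + n.+1%:R) / r.
have c0E : c0 n.+1 a q r = r * al0 - n.+1%:R by rewrite /c0 /al0 mulrA.
have c1E : c1 n.+1 b p r = r * al1 - n.+1%:R by rewrite /c1 /al1 mulrA.
have cE : c = r * gam - n.+1%:R.
  by rewrite /gam mulrC divfK ?addrK// gt_eqF.
have ltE x y : (r * x - n.+1%:R < r * y - n.+1%:R) = (x < y).
  by rewrite ltrD2r ltr_pM2l.
(* Up to the cut-off the function is |x|^(-gam), whose L^r integrand is |x|^(-N), divergent at both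
   ends. The other two norms converge at the origin when gam is below al0 and al1, and at infinity
   when it is above them. *)
have sub_low : gam < al0 -> gam < al1 ->
    ~ W_sub_L n.+1 a b q p c r /\ ~ Wt_sub_L n.+1 a b q p c r.
  move=> g0 g1; apply: (@profile_not_sub _ n (-1) _ _ _ _ _ _ (- gam) 0) => //.
  - by right.
  - by left; rewrite mulN1r ltrN2.
  - by right; left; rewrite mulN1r ltrN2.
  - by left.
  - by rewrite mulN1r.
  - by rewrite mul0r.
have sub_high : al0 < gam -> al1 < gam ->
    ~ W_sub_L n.+1 a b q p c r /\ ~ Wt_sub_L n.+1 a b q p c r.
  move=> g0 g1; apply: (@profile_not_sub _ n 1 _ _ _ _ _ _ gam 0) => //.
  - by left.
  - by left; rewrite mul1r.
  - by right; left; rewrite mul1r.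
  - by left.
  - by rewrite mul1r.
  - by rewrite mul0r.
have emb_sub : ~ W_sub_L n.+1 a b q p c r /\ ~ Wt_sub_L n.+1 a b q p c r ->
    ~ W_emb_L n.+1 a b q p c r /\ ~ Wt_emb_L n.+1 a b q p c r.
  by move=> [h1 h2]; split => -[].
have r10 : 0 <= r^-1 by rewrite invr_ge0 ltW.
have r1r : r^-1 * r <= 1 by rewrite mulVf ?gt_eqF.
have rlt s : r < s -> 1 < r^-1 * s.
  by move=> rs; rewrite mulrC ltr_pdivlMr// mul1r.
have rlt1 s : 0 < s -> r < s -> 1 < (r^-1 + 1) * s.
  by move=> s0 rs; have := rlt _ rs; lra.
have sgnP (x y : R) : x != y -> exists sgm : R,
    (sgm = 1 \/ sgm = -1) /\ sgm * x < sgm * y.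
  move=> /lt_total/orP[xy|yx]; first by exists 1; rewrite !mul1r; split => //; left.
  by exists (-1); rewrite !mulN1r ltrN2; split => //; right.
split.
  rewrite lt_min gt_max c0E c1E.
  have [l0 l1 u0 u1] : [/\ (c < r * al0 - n.+1%:R) = (gam < al0),
      (c < r * al1 - n.+1%:R) = (gam < al1), (r * al0 - n.+1%:R < c) = (al0 < gam) &
      (r * al1 - n.+1%:R < c) = (al1 < gam)].
    by split; rewrite [in LHS]cE ltE.
  rewrite l0 l1 u0 u1; case=> [[/andP[g0 g1]|/andP[g0 g1]]|[h nc]].
  - exact: sub_low.
  - exact: sub_high.
  case: h => -[h1 h2].
    have al1_le : al1 <= 0 by rewrite pmulr_lle0 ?invr_gt0//; lra.
    have al0_gt : 0 < al0 by rewrite divr_gt0//; lra.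
    (* For gam <= 0 the function tends to 1 at the origin: it lies in L^q there as a > -N and not in
       L^r as c <= -N, and its gradient comes from the cut-off alone. For gam > 0 the excluded
       interval forces gam > al0. *)
    have [gam_le|gam_gt] := leP gam 0.
      apply: (@profile_not_sub _ n (-1) _ _ _ _ _ _ 0 0) => //.
      - by right.
      - by left; rewrite mulN1r oppr_lt0.
      - by left.
      - by left.
      - by rewrite mulN1r oppr_ge0.
      - by rewrite mul0r.
    apply: sub_high; last by apply: le_lt_trans gam_gt.
    rewrite ltNge; apply/negP => g0; apply: nc; right; split.
      by have := mulr_gt0 r0 gam_gt; lra.
    by rewrite cE lerD2r ler_pM2l.
  have al1_ge : 0 <= al1 by rewrite divr_ge0 ?(ltW p0)//; lra.
  have al0_lt : al0 < 0 by rewrite pmulr_llt0 ?invr_gt0//; lra.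
  (* The mirror image, with a function tending to 1 at infinity. *)
  have [gam_ge|gam_lt] := leP 0 gam.
    apply: (@profile_not_sub _ n 1 _ _ _ _ _ _ 0 0) => //.
    - by left.
    - by left; rewrite mul1r.
    - by left.
    - by left.
    - by rewrite mul1r.
    - by rewrite mul0r.
  apply: sub_low; last exact: lt_le_trans gam_lt al1_ge.
  rewrite ltNge; apply/negP => g0; apply: nc; left; split.
    by rewrite cE lerD2r ler_pM2l.
  by have : r * gam < 0 by [rewrite pmulr_rlt0]; lra.
have gamE x : c = r * x - n.+1%:R -> gam = x.
  by rewrite /gam => ->; rewrite subrK mulrC mulKf// gt_eqF.
rewrite c0E c1E => -[[al01 /gamE gal0 rq]|[[al01 /gamE gal1 rp]|
  [[al01 rpq /gamE gal0]|[aN bN rq /gamE gal0]]]].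
- move: rq; rewrite neq_lt => /orP[rq|qr]; last first.
    by split=> [/W_emb_c1|/(Wt_emb_c1 p0)] [C C0]; exact: bump_not_emb.
  (* The end is chosen where the gradient has an exponential gap; the L^q norm is critical and is
     saved by the power, as q / r > 1. *)
  have [sgm [sgm1 lt01]] : exists sgm : R, (sgm = 1 \/ sgm = -1) /\ sgm * al1 < sgm * al0.
    by apply: sgnP; rewrite eq_sym.
  apply: emb_sub; apply: (@profile_not_sub _ n sgm _ _ _ _ _ _ (sgm * al0) r^-1) => //.
  + by right; split => //; exact: rlt.
  + by right; left.
  + by right; left.
  + by rewrite -/gam gal0.
(* The roles are exchanged: the L^q norm has the exponential gap, and the gradient is critical,
   saved by p / r > 1. *)
- have [sgm [sgm1 lt01]] := sgnP _ _ al01.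
  apply: emb_sub; apply: (@profile_not_sub _ n sgm _ _ _ _ _ _ (sgm * al1) r^-1) => //.
  + by left.
  + by right; right; split => //; exact: rlt.
  + by right; right; split => //; exact: rlt1.
  + by rewrite -/gam gal1.
(* Both exponents are critical at either end, so the power alone must make both norms finite; hence
   r < min(p, q). *)
- move: rpq; rewrite lt_min => /andP[rp rq].
  apply: emb_sub; apply: (@profile_not_sub _ n 1 _ _ _ _ _ _ (1 * al0) r^-1) => //.
  + by left.
  + by right; split => //; exact: rlt.
  + by right; right; rewrite -/al1 al01; split => //; exact: rlt.
  + by right; right; rewrite -/al1 al01; split => //; exact: rlt1.
  + by rewrite -/gam gal0.
(* With al = 0 the derivative loses the term that would demand r < p. What remains of the power
   gains 1/(1+t), and (1/r + 1) p > 1 follows from p >= 1. *)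
- have al00 : al0 = 0 by rewrite /al0 aN addNr mul0r.
  have al10 : al1 = 0 by rewrite /al1 bN addrAC subrK subrr mul0r.
  apply: emb_sub; apply: (@profile_not_sub _ n 1 _ _ _ _ _ _ 0 r^-1) => //.
  + by left.
  + by right; rewrite -/al0 al00 mulr0; split => //; exact: rlt.
  + by left.
  + right; right; rewrite -/al1 al10 mulr0; split => //.
    by have : 0 < r^-1 by [rewrite invr_gt0]; nra.
  + by rewrite -/gam gal0 al00 mulr0.
Qed.
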